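(* Let $P(M,G)$ be a reductive $G$-structure on a principal bundle $Q(M,H)$, with $\mathfrak h=\mathfrak g\oplus\mathfrak m$ the corresponding decomposition, let $m=\dim M$, and let $i_P\colon P\to Q$ be the canonical embedding. Then there exists a canonical decomposition of the pull-back vector bundle $i_P^{*}(TQ)\to P$, $$i_P^{*}(TQ)=TP\oplus\mathcal M(P),$$ i.e. at each $u\in P$ one has $T_uQ=T_uP\oplus\mathcal M_u$, where $\mathcal M_u$ is the fibre over $u$ of the vector subbundle $\mathcal M(P)\to P$ of $i_P^{*}(VQ)\to P$. Here $\mathcal M(P)$ is defined as $$\mathcal M(P):=(W^{1,1}P\times\mathfrak m)/(G^1_m\rtimes\mathfrak g\otimes\mathbb R^m),$$ where $\mathfrak m$ is regarded as a left $G^1_m\rtimes\mathfrak g\otimes\mathbb R^m$-manifold with the trivial action.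
   Context: Reductive Lie subgroup: a Lie subgroup $G$ of a Lie group $H$, with Lie algebras $\mathfrak g\subset\mathfrak h$, for which there is a direct sum decomposition $\mathfrak h=\mathfrak g\oplus\mathfrak m$ with $\mathfrak m$ a vector subspace satisfying $\mathrm{Ad}_a(\mathfrak m)\subset\mathfrak m$ for all $a\in G$; such an $\mathfrak m$ is fixed. A reductive $G$-structure on a principal bundle $Q(M,H)$ (base $M$, structure group $H$ acting on the right) is a principal subbundle $P(M,G)$ of $Q(M,H)$ over the same base such that $G$ is a reductive Lie subgroup of $H$. $i_P^{*}(TQ)=P\times_Q TQ=\{(u,v)\in P\times TQ\mid i_P(u)=\tau_Q(v)\}$, where $\tau_Q\colon TQ\to Q$ is the tangent projection; $VQ$ is the vertical tangent bundle of $Q\to M$. $G^1_m\cong GL(m,\mathbb R)$ is the group of $1$-jets $j^1_0\alpha$ of locally invertible maps $\alpha\colon\mathbb R^m\to\mathbb R^m$ with $\alpha(0)=0$. $T^1_mG$ is the group of $1$-jets $j^1_0a$ of maps $a\colon\mathbb R^m\to G$, with pointwise multiplication. $W^{1,1}_mG=G^1_m\rtimes T^1_mG$ has multiplication $(j^1_0\alpha,j^1_0a)\odot(j^1_0\beta,j^1_0b)=(j^1_0(\alpha\circ\beta),j^1_0((a\circ\beta)\cdot b))$. $W^{1,1}P=L^1M\times_M J^1P$, with $L^1M$ the linear frame bundle of $M$ and $J^1P$ the bundle of $1$-jets of local sections of $P$; its points are $(j^1_0\epsilon,j^1_x\sigma)$ with $\epsilon\colon\mathbb R^m\to M$ locally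 invertible, $\epsilon(0)=x$, and $\sigma$ a local section of $P$ near $x$. It is a principal $W^{1,1}_mG$-bundle over $M$ with right action $(j^1_0\epsilon,j^1_x\sigma)\odot(j^1_0\alpha,j^1_0a)=(j^1_0(\epsilon\circ\alpha),j^1_x(\sigma\cdot(a\circ\alpha^{-1}\circ\epsilon^{-1})))$. The group $G^1_m\rtimes\mathfrak g\otimes\mathbb R^m$ is the kernel of the homomorphism $W^{1,1}_mG\to G$, $(j^1_0\alpha,j^1_0a)\mapsto a(0)$, and $\mathrm{pr}_2\colon W^{1,1}P\to P$, $(j^1_0\epsilon,j^1_x\sigma)\mapsto\sigma(x)$, is a principal bundle with this structure group. $\mathcal M(P)$ is regarded as a subbundle of $i_P^{*}(VQ)$ by sending the class of $(w,\mu)$, $w\in W^{1,1}P$, $\mu\in\mathfrak m$, with $u=\mathrm{pr}_2(w)$, to the value $\frac{d}{dt}\big|_{t=0}u\cdot\exp(t\mu)\in V_uQ$ of the fundamental vector field of $\mu$. *)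

(* Defs.v *)
(* MathComp-Analysis: manifolds are built over an arbitrary R : realType. *)
From HB Require Import structures.
From mathcomp Require Import all_boot all_order all_algebra.
From mathcomp Require Import all_classical all_reals all_analysis.

Set Implicit Arguments.
Unset Strict Implicit.
Unset Printing Implicit Defensive.

Import Order.TTheory GRing.Theory Num.Theory.
Import numFieldNormedType.Exports.

Local Open Scope classical_set_scope.
Local Open Scope ring_scope.

Section SmoothCalculus.
Context {R : realType}.

(* Only meant for finite-dimensional V, where f is C^(k+1) on an open set U iff
   it is differentiable on U with all its directional derivatives C^k on U. *)
Fixpoint ck (V W : normedModType R) (k : nat) (U : set V) (f : V -> W) : Prop :=
  if k is k'.+1 then
    (forall x, U x -> differentiable f x) /\
    (forall v : V, ck k' U (fun x => 'D_v f x))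
  else forall x, U x -> {for x, continuous f}.

Definition cinfty_near (V W : normedModType R) (f : V -> W) (x : V) : Prop :=
  exists U : set V, open_nbhs x U /\ forall k, ck k U f.

End SmoothCalculus.

(* A local homeomorphism chart_to : chart_dom -> E with inverse chart_from; both
   are total functions, meaningless outside chart_dom and its image. *)
Record chart (T E : Type) := Chart {
  chart_dom : set T;
  chart_to : T -> E;
  chart_from : E -> T }.

(* The data of a space with charts, without axioms: smoothness of maps makes
   sense at this level, for manifolds, finite products and model spaces. *)
Record charted (R : realType) := Charted {
  charted_pt :> topologicalType;
  charted_model : normedModType R;
  charts : set (chart charted_pt charted_model) }.

Definition model_charted (R : realType) (E : normedModType R) : charted R :=
  @Charted R E E [set Chart setT id id].

Definition prod_chart T E T' E' (c : chart T E) (d : chart T' E') :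
    chart (T * T') (E * E') :=
  Chart (chart_dom c `*` chart_dom d)
        (fun p => (chart_to c p.1, chart_to d p.2))
        (fun q => (chart_from c q.1, chart_from d q.2)).

Definition prod_charted (R : realType) (X Y : charted R) : charted R :=
  @Charted R (X * Y)%type (charted_model X * charted_model Y)%type
    [set e | exists c d, [/\ charts c, charts d & e = prod_chart c d]].

Notation realline R := (model_charted (R : normedModType R)).
Notation euclid R m := (model_charted ('rV[R]_m : normedModType R)).

Section SmoothMaps.
Context {R : realType}.
Implicit Types X Y Z : charted R.

(* Smoothness in a neighbourhood of x. Local maps are represented everywhere by
   total functions whose values away from the point considered are irrelevant. *)
Definition smooth_at X Y (f : X -> Y) (x : X) : Prop :=
  {for x, continuous f} /\
  forall c d, charts c -> charts d -> chart_dom c x -> chart_dom d (f x) ->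
    cinfty_near (fun z => chart_to d (f (chart_from c z))) (chart_to c x).

Definition smooth X Y (f : X -> Y) : Prop := forall x, smooth_at f x.

Definition smooth2_at X Y Z (f : X -> Y -> Z) (x : X) (y : Y) : Prop :=
  @smooth_at (prod_charted X Y) Z (fun p => f p.1 p.2) (x, y).

Definition smooth2 X Y Z (f : X -> Y -> Z) : Prop :=
  forall x y, smooth2_at f x y.

(* g is a smooth local inverse of the locally invertible map f at x. *)
Definition local_inverse X Y (f : X -> Y) (x : X) (g : Y -> X) : Prop :=
  [/\ smooth_at f x, smooth_at g (f x),
      \forall x' \near x, g (f x') = x' &
      \forall y \near f x, f (g y) = y].

Definition locally_invertible X Y (f : X -> Y) (x : X) : Prop :=
  exists g, local_inverse f x g.

End SmoothMaps.

(* An n-dimensional Hausdorff second countable smooth manifold; the atlas need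
   not be maximal. *)
Record manifold (R : realType) (n : nat) := Manifold {
  manifold_pt : topologicalType;
  atlas : set (chart manifold_pt 'rV[R]_n);
  atlas_cover : forall x, exists2 c, atlas c & chart_dom c x;
  atlas_dom_open : forall c, atlas c -> open (chart_dom c);
  atlas_img_open : forall c, atlas c -> open (chart_to c @` chart_dom c);
  atlas_toK : forall c, atlas c ->
    forall x, chart_dom c x -> chart_from c (chart_to c x) = x;
  atlas_to_continuous : forall c, atlas c ->
    forall x, chart_dom c x -> {for x, continuous (chart_to c)};
  atlas_from_continuous : forall c, atlas c ->
    forall x, chart_dom c x -> {for chart_to c x, continuous (chart_from c)};
  atlas_compatible : forall c d, atlas c -> atlas d ->
    forall x, chart_dom c x -> chart_dom d x ->
    cinfty_near (fun z => chart_to d (chart_from c z)) (chart_to c x);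
  manifold_hausdorff : hausdorff_space manifold_pt;
  manifold_second_countable : @second_countable manifold_pt }.

Coercion charted_of_manifold (R : realType) n (M : manifold R n) : charted R :=
  @Charted R (manifold_pt M) 'rV[R]_n (@atlas R n M).

Section TangentSpaces.
Context {R : realType}.
Implicit Types X Y : charted R.

(* A tangent vector at x is identified with the operator
   f |-> d/dt|_0 f (c t) on the functions f smooth near x, where c is a smooth
   curve with c 0 = x. Operators vanish on the other functions, so that equality
   and linear operations are the pointwise ones on (X -> R) -> R. *)
Definition tvec X : Type := (X -> R) -> R.
HB.instance Definition _ X := GRing.Lmodule.on (tvec X).

Definition smooth_fun_at X (f : X -> R) (x : X) : Prop :=
  @smooth_at R X (realline R) f x.

Definition smooth_curve X (c : R -> X) : Prop :=
  @smooth_at R (realline R) X c (0 : R).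

Definition velocity X (c : R -> X) : tvec X := fun f : X -> R =>
  if `[< smooth_fun_at f (c 0) >] then derive1 (fun t : R => f (c t)) 0 else 0.

Definition tangent X (x : X) : set (tvec X) :=
  [set D | exists c : R -> X, [/\ smooth_curve c, c 0 = x & D = velocity c]].

Definition tmap X Y (phi : X -> Y) (x : X) (D : tvec X) : tvec Y :=
  fun f : Y -> R =>
  if `[< smooth_fun_at f (phi x) >] then D (fun x' => f (phi x')) else 0.

Definition immersion X Y (phi : X -> Y) : Prop :=
  smooth phi /\
  forall x D, tangent x D -> tmap phi x D = 0 -> D = 0.

Definition vsubspace (V : lmodType R) (A : set V) : Prop :=
  A 0 /\ forall (a : R) v w, A v -> A w -> A (a *: v + w).

Definition direct_sum (V : lmodType R) (A B C : set V) : Prop :=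
  [/\ vsubspace A, vsubspace B, A `&` B = [set 0] &
      C = [set v | exists a b, [/\ A a, B b & v = a + b]]].

Definition is_basis (V : lmodType R) (A : set V) (r : nat) (b : 'I_r -> V) :
    Prop :=
  (forall c : 'I_r -> R, \sum_k c k *: b k = 0 -> forall k, c k = 0) /\
  A = [set v | exists c : 'I_r -> R, v = \sum_k c k *: b k].

(* A local section s of the pull-back bundle i^*(TY) -> X is smooth iff
   x |-> s x f is, for every function f smooth near i x. *)
Definition smooth_section_at X Y (i : X -> Y) (s : X -> tvec Y) (x : X) : Prop :=
  (\forall x' \near x, tangent (i x') (s x')) /\
  forall f : Y -> R, smooth_fun_at f (i x) -> smooth_fun_at (fun x' => s x' f) x.

(* A smooth vector subbundle of rank r of i^*(TY) -> X: a family of subspaces of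
   the fibres spanned by a smooth local frame near each point. *)
Definition vector_subbundle X Y (i : X -> Y) (E : X -> set (tvec Y)) (r : nat) :
    Prop :=
  forall x, exists s : 'I_r -> X -> tvec Y,
    (forall k, smooth_section_at i (s k) x) /\
    \forall x' \near x, is_basis (E x') (fun k => s k x').

End TangentSpaces.

Record lie_group (R : realType) (n : nat) := LieGroup {
  lie_manifold :> manifold R n;
  lie_mul : lie_manifold -> lie_manifold -> lie_manifold;
  lie_one : lie_manifold;
  lie_inv : lie_manifold -> lie_manifold;
  lie_mulA : forall a b c, lie_mul a (lie_mul b c) = lie_mul (lie_mul a b) c;
  lie_mul1 : forall a, lie_mul lie_one a = a;
  lie_mulV : forall a, lie_mul (lie_inv a) a = lie_one;
  lie_mul_smooth : smooth2 lie_mul;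
  lie_inv_smooth : smooth lie_inv }.
Arguments lie_mul {R n l} : rename.
Arguments lie_inv {R n l} : rename.
Arguments lie_one {R n} l : rename.

Section LieGroups.
Context {R : realType} {n : nat}.
Implicit Types H : lie_group R n.

Definition lie_algebra H : set (tvec H) := tangent (lie_one H).

Definition lie_Ad H (a : H) (v : tvec H) : tvec H :=
  tmap (fun b : H => lie_mul (lie_mul a b) (lie_inv a)) (lie_one H) v.

Definition one_parameter_subgroup H (c : R -> H) : Prop :=
  @smooth R (realline R) H c /\ forall s t, c (s + t) = lie_mul (c s) (c t).

(* exp_curve mu t = exp (t mu): the one-parameter subgroup generated by mu. *)
Definition exp_curve H (mu : tvec H) : R -> H :=
  xget (fun=> lie_one H)
    [set c | one_parameter_subgroup c /\ velocity c = mu].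

End LieGroups.
Arguments lie_algebra {R n} H _.

(* pb_trivial: over a neighbourhood U of each point, u |-> (pb_proj u, phi u) is
   an equivariant diffeomorphism onto U x G, with inverse psi. *)
Record principal_bundle (R : realType) (p m g : nat) (M : manifold R m)
    (G : lie_group R g) := PrincipalBundle {
  pb_total :> manifold R p;
  pb_proj : pb_total -> M;
  pb_act : pb_total -> G -> pb_total;
  pb_proj_smooth : smooth pb_proj;
  pb_act_smooth : smooth2 pb_act;
  pb_act1 : forall u, pb_act u (lie_one G) = u;
  pb_actM : forall u a b, pb_act u (lie_mul a b) = pb_act (pb_act u a) b;
  pb_act_free : forall u a, pb_act u a = u -> a = lie_one G;
  pb_act_fibre : forall u v,
    pb_proj u = pb_proj v <-> exists a, v = pb_act u a;
  pb_trivial : forall x : M, exists (U : set M) (phi : pb_total -> G)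
      (psi : M -> G -> pb_total),
    [/\ open_nbhs x U,
        forall u, U (pb_proj u) ->
          [/\ smooth_at phi u, psi (pb_proj u) (phi u) = u &
              forall a, phi (pb_act u a) = lie_mul (phi u) a] &
        forall y a, U y ->
          [/\ smooth2_at psi y a, pb_proj (psi y a) = y & phi (psi y a) = a]] }.
Arguments pb_proj {R p m g M G p0} : rename.
Arguments pb_act {R p m g M G p0} : rename.

Section ReductiveStructures.
Context {R : realType} {m g h p q : nat} {M : manifold R m}.
Context {G : lie_group R g} {H : lie_group R h}.
Context {P : principal_bundle p M G} {Q : principal_bundle q M H}.

Definition vertical (u : Q) : set (tvec Q) :=
  tangent u `&` [set D | tmap pb_proj u D = 0].

(* Lie subgroups and principal subbundles are presented by their inclusions,
   which are injective immersions, not necessarily topological embeddings. *)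
Definition lie_subgroup (j : G -> H) : Prop :=
  [/\ immersion j, injective j &
      forall a b, j (lie_mul a b) = lie_mul (j a) (j b)].

Definition principal_subbundle (j : G -> H) (i : P -> Q) : Prop :=
  [/\ immersion i, injective i,
      forall u a, i (pb_act u a) = pb_act (i u) (j a) &
      forall u, pb_proj (i u) = pb_proj u].

Definition reductive_decomposition (j : G -> H) (mm : set (tvec H)) : Prop :=
  direct_sum (tmap j (lie_one G) @` lie_algebra G) mm (lie_algebra H) /\
  forall a : G, lie_Ad (j a) @` mm `<=` mm.

Definition reductive_structure (j : G -> H) (i : P -> Q) (mm : set (tvec H)) :
    Prop :=
  [/\ lie_subgroup j, principal_subbundle j i & reductive_decomposition j mm].

Definition fundamental (u : Q) (mu : tvec H) : tvec Q :=
  velocity (fun t : R => pb_act u (exp_curve mu t)).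

End ReductiveStructures.

Section Jets.
Context {R : realType}.
Implicit Types X Y : charted R.

(* A 1-jet is recorded by its source, its target and the set of all the maps
   representing it. *)
Record jet X Y := Jet {
  jet_src : X;
  jet_tgt : Y;
  jet_rep : set (X -> Y) }.

(* Two maps smooth near x have the same 1-jet at x iff they agree at x and map
   every curve through x to curves with the same velocity. *)
Definition j1 X Y (x : X) (f : X -> Y) : jet X Y :=
  Jet x (f x)
    [set f' | [/\ smooth_at f' x, f' x = f x &
       forall c : R -> X, smooth_curve c -> c 0 = x ->
         velocity (fun t => f' (c t)) = velocity (fun t => f (c t))]].

End Jets.

Section AssociatedBundle.
Context {R : realType} {m g h p q : nat} {M : manifold R m}.
Context {G : lie_group R g} {H : lie_group R h}.
Variables (P : principal_bundle p M G) (Q : principal_bundle q M H).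

Let zero : euclid R m := 0 : 'rV[R]_m.

(* Representatives (eps, sigma) of a point of W^{1,1} P, with x = eps 0. *)
Definition W11rep (eps : euclid R m -> M) (sigma : M -> P) : Prop :=
  [/\ locally_invertible eps zero, smooth_at sigma (eps zero) &
      \forall y \near eps zero, pb_proj (sigma y) = y].

Definition W11_jet (eps : euclid R m -> M) (sigma : M -> P) :
    jet (euclid R m) M * jet M P :=
  (j1 zero eps, j1 (eps zero) sigma).

(* W^{1,1} P = L^1 M x_M J^1 P *)
Definition W11 : set (jet (euclid R m) M * jet M P) :=
  [set w | exists eps sigma, W11rep eps sigma /\ w = W11_jet eps sigma].

Definition W11_pr2 (w : jet (euclid R m) M * jet M P) : P := jet_tgt w.2.

(* Representatives (alpha, a) of an element of W^{1,1}_m G. *)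
Definition W11G_rep (alpha : euclid R m -> euclid R m) (a : euclid R m -> G) :
    Prop :=
  [/\ locally_invertible alpha zero, alpha zero = zero & smooth_at a zero].

Definition W11G_jet (alpha : euclid R m -> euclid R m) (a : euclid R m -> G) :
    jet (euclid R m) (euclid R m) * jet (euclid R m) G :=
  (j1 zero alpha, j1 zero a).

Definition W11G : set (jet (euclid R m) (euclid R m) * jet (euclid R m) G) :=
  [set k | exists alpha a, W11G_rep alpha a /\ k = W11G_jet alpha a].

(* The kernel of W^{1,1}_m G -> G, (j alpha, j a) |-> a 0, which is the group
   G^1_m |x (g (x) R^m). *)
Definition W11G_ker : set (jet (euclid R m) (euclid R m) * jet (euclid R m) G) :=
  [set k | W11G k /\ jet_tgt k.2 = lie_one G].

(* The graph of the right action (w, k) |-> w' of W^{1,1}_m G on W^{1,1} P. *)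
Definition W11_act (w : jet (euclid R m) M * jet M P)
    (k : jet (euclid R m) (euclid R m) * jet (euclid R m) G)
    (w' : jet (euclid R m) M * jet M P) : Prop :=
  exists (eps : euclid R m -> M) (sigma : M -> P) (epsV : M -> euclid R m)
         (alpha alphaV : euclid R m -> euclid R m) (a : euclid R m -> G),
    [/\ W11rep eps sigma /\ w = W11_jet eps sigma,
        W11G_rep alpha a /\ k = W11G_jet alpha a,
        local_inverse eps zero epsV, local_inverse alpha zero alphaV &
        w' = (j1 zero (fun z => eps (alpha z)),
              j1 (eps zero)
                 (fun y => pb_act (sigma y) (a (alphaV (epsV y)))))].

(* The points of W^{1,1} P x m modulo G^1_m |x (g (x) R^m), as orbits; the
   action on the second factor is trivial. *)
Definition assoc_class (w : jet (euclid R m) M * jet M P) (mu : tvec H) :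
    set ((jet (euclid R m) M * jet M P) * tvec H) :=
  [set z | exists2 k, W11G_ker k & W11_act w k z.1 /\ z.2 = mu].

(* The fibre over u of M(P) -> P. *)
Definition assoc_fibre (mm : set (tvec H)) (u : P) :
    set (set ((jet (euclid R m) M * jet M P) * tvec H)) :=
  [set C | exists w mu, [/\ W11 w, mm mu, W11_pr2 w = u & C = assoc_class w mu]].

(* The map M(P) -> i^*(VQ): the value of the fundamental vector field of mu at
   i u, for a representative (w, mu) of C with u = pr2 w. *)
Definition assoc_map (i : P -> Q)
    (C : set ((jet (euclid R m) M * jet M P) * tvec H)) : tvec Q :=
  xget 0 [set D | exists w mu, C (w, mu) /\
                    D = fundamental (i (W11_pr2 w)) mu].

End AssociatedBundle.

(* Main.v *)
(* The orbits of the kernel of W^{1,1}_m G -> G in W^{1,1} P are the fibres of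
   pr_2: two representatives over the same u differ by the change of frame
   eps^-1 o eps' and by the G-valued function dividing one local section by the
   other, whose value at 0 is 1. Hence a point of M(P) over u is just an element
   mu of mm, and it is mapped to the fundamental vector of mu at i u. Since
   one-parameter subgroups exist (Picard iteration for left-invariant fields),
   this vector is the image of mu under the differential of a |-> i u * a, which
   is linear, injective on the Lie algebra of H, and has the vertical space as
   image. The image of TP meets the vertical space in the image of the Lie algebra
   of G and surjects onto TM, so the splitting of T_(i u) Q follows from
   that of the Lie algebra of H. *)

From HB Require Import structures.
Require Import Defs.
From mathcomp Require Import all_boot all_order all_algebra.
From mathcomp Require Import all_classical all_reals all_analysis.
From mathcomp Require Import ring lra.

Set Implicit Arguments.
Unset Strict Implicit.
Unset Printing Implicit Defensive.

Import Order.TTheory GRing.Theory Num.Theory.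
Import numFieldNormedType.Exports.

Local Open Scope classical_set_scope.
Local Open Scope ring_scope.

(** * Calculus of smooth maps *)

(** Only single curves [exp_curve mu] are needed, never the joint smoothness of the exponential map:
    for fixed [mu] the fundamental field is smooth in the base point because it is a derivative at
    [t = 0] of a smooth map of two variables. Existence of these curves cannot be bypassed, since
    [exp_curve] is a choice whose default is the constant curve, for which every fundamental vector
    would vanish. No dimension count and no inverse function theorem enter. Local trivializations
    give a smooth division map and smooth local sections; from these come the injectivity of the
    orbit map on the Lie algebra, the description of vertical vectors and the lifting of base
    vectors. The encoding of tangent vectors has a price. They are operators that vanish on
    functions not smooth at the point, so every smoothness proof for a section must discharge this
    guard at all nearby points; and since their sum is pointwise, a chart is needed to see that a
    sum of velocities is again a velocity. *)

Section SmoothCalculusTheory.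
Context {R : realType}.

Lemma near_eq_differentiable (V W : normedModType R) (f g : V -> W) (x : V) :
  (\forall y \near x, f y = g y) -> differentiable f x -> differentiable g x.
Proof.
move=> fg df.
suff dr : differentiable (g - f) x.
  have -> : g = f + (g - f) by rewrite addrC subrK.
  exact: differentiableD.
have r0 : g x - f x = 0 by rewrite (nbhs_singleton fg) subrr.
(* [g - f] vanishes near [x], so it is differentiable there with differential zero. *)
have oE : (g - f) \o shift x = cst ((g - f) x) + (\0 : V -> W) +o_ 0 id.
  apply/eqaddoP => e e0.
  have /= fg0 : \forall h \near (0 : V), f (h + x) = g (h + x).
    by move: fg; rewrite (near_shift 0) /=; apply: filterS => y; rewrite subr0.
  near=> h; rewrite /= !fctE /= r0 addr0 subr0.
  by rewrite (near fg0 h) // subrr normr0 mulr_ge0 // ltW.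
have c0 : continuous (\0 : V -> W) by exact: cst_continuous.
by apply/diff_locallyP; rewrite (diff_unique c0 oE).
Unshelve. all: by end_near. Qed.

(** Coordinates are asked for without independence of the [e i], which makes the property immediate
    for products. It serves to replace a derivative in a moving direction by finitely many
    derivatives in fixed ones. *)
Definition findim (V : normedModType R) : Prop :=
  exists n (e : 'I_n -> V) (phi : 'I_n -> {linear V -> R}),
    (forall i, continuous (phi i)) /\ forall v, v = \sum_i phi i v *: e i.

Lemma findim_real : findim R.
Proof.
exists 1%N, (fun=> 1), (fun=> idfun); split => [i x|v]; first exact.
by rewrite big_ord1 /= /GRing.scale/= mulr1.
Qed.

Lemma findim_rV n : findim 'rV[R]_n.
Proof.
pose c (i : 'I_n) (v : 'rV[R]_n) : R := v ord0 i.
have cl i : linear (c i) by move=> a u v; rewrite /c !mxE.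
pose phi i : {linear 'rV[R]_n -> R} :=
  HB.pack (c i) (GRing.isLinear.Build _ _ _ _ _ (cl i)).
exists n, (fun i => delta_mx ord0 i), phi; split => [i|v].
  exact: coord_continuous.
exact: row_sum_delta.
Qed.

Lemma findim_prod (V W : normedModType R) :
  findim V -> findim W -> findim (V * W)%type.
Proof.
move=> [n [e [phi [pc pE]]]] [n' [e' [phi' [pc' pE']]]].
pose c (i : 'I_(n + n')) (v : V * W) : R :=
  match fintype.split i with inl k => phi k v.1 | inr k => phi' k v.2 end.
have cl i : linear (c i).
  by move=> a u v; rewrite /c; case: fintype.split => k /=; rewrite linearP.
pose psi i : {linear (V * W)%type -> R} :=
  HB.pack (c i) (GRing.isLinear.Build _ _ _ _ _ (cl i)).
exists (n + n')%N, (fun i => match fintype.split i with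
  inl k => (e k, 0) | inr k => (0, e' k) end), psi; split => [i|[v w]].
  rewrite /= /c; case: fintype.split => k x.
    exact: (@continuous_comp _ _ _ fst (phi k)) (@cvg_fst _ _ _ _ _) (pc _ _).
  exact: (@continuous_comp _ _ _ snd (phi' k)) (@cvg_snd _ _ _ _ _) (pc' _ _).
rewrite big_split_ord /= [v in LHS]pE [w in LHS]pE'.
rewrite /c; under eq_bigr do rewrite (unsplitK (inl _)).
under [X in _ = _ + X]eq_bigr do rewrite (unsplitK (inr _)).
apply: injective_projections => /=.
  rewrite !raddf_sum/= [X in _ + X]big1 ?addr0 //.
  by move=> i _; rewrite scaler0.
rewrite !raddf_sum/= [X in X + _]big1 ?add0r //.
by move=> i _; rewrite scaler0.
Qed.

Section Ck.
Variables V W : normedModType R.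
Implicit Types (k : nat) (U : set V).

Lemma ckW k U (f : V -> W) : ck k.+1 U f -> ck k U f.
Proof.
elim: k f => [|k IH] f /= [df Df].
  by move=> x Ux; exact/differentiable_continuous/df.
by split => // v; exact/IH/Df.
Qed.

Lemma ck_subset k U U' (f : V -> W) : U' `<=` U -> ck k U f -> ck k U' f.
Proof.
move=> UU; elim: k f => [|k IH] f /=; first by move=> cf x /UU/cf.
by move=> [df Df]; split => [x /UU/df//|v]; exact/IH/Df.
Qed.

(** Openness turns agreement on [U] into agreement near each point of [U], which passes to
    directional derivatives. *)
Lemma ck_ext k U (f g : V -> W) : open U -> (forall x, U x -> f x = g x) ->
  ck k U f -> ck k U g.
Proof.
move=> oU; elim: k f g => [|k IH] f g fg /=.
  move=> cf x Ux; have fgx : \forall y \near x, f y = g y.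
    by apply: filterS fg _; exact: open_nbhs_nbhs.
  have cfx : f @ x --> f x := cf _ Ux.
  rewrite /prop_for /continuous_at -(fg x Ux).
  exact: cvg_trans (near_eq_cvg fgx) cfx.
have fgx x : U x -> \forall y \near x, f y = g y.
  by move=> Ux; apply: filterS fg _; exact: open_nbhs_nbhs.
move=> [df Df]; split => [x Ux|v].
  exact: near_eq_differentiable (fgx x Ux) (df _ Ux).
by apply: IH (Df v) => x Ux; exact/near_eq_derive/fgx.
Qed.

Lemma ck_cst k U (w : W) : ck k U (cst w).
Proof.
elim: k w => [|k IH] w /=; first by move=> *; exact: cst_continuous.
split => [x _|v]; first exact: differentiable_cst.
by under eq_fun do rewrite derive_cst; exact: IH.
Qed.

Lemma ckD k U (f g : V -> W) : open U -> ck k U f -> ck k U g ->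
  ck k U (fun x => f x + g x).
Proof.
move=> oU; elim: k f g => [|k IH] f g /=.
  by move=> cf cg x Ux; apply: continuousD; [exact: cf|exact: cg].
move=> [df Df] [dg Dg]; split => [x Ux|v].
  by apply: differentiableD; [exact: df|exact: dg].
apply: (@ck_ext k U (fun x => 'D_v f x + 'D_v g x)) => //; last exact: IH.
move=> x Ux; have dfx := df _ Ux; have dgx := dg _ Ux.
by rewrite deriveD //; exact: diff_derivable.
Qed.

Lemma ck_sum k U n (f : 'I_n -> V -> W) : open U -> (forall i, ck k U (f i)) ->
  ck k U (fun x => \sum_i f i x).
Proof.
move=> oU; elim: n f => [|n IH] f cf.
  by under eq_fun do rewrite big_ord0; exact: ck_cst.
under eq_fun do rewrite big_ord_recr /=.
by apply: ckD => //; exact: IH.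
Qed.

End Ck.

Lemma ck_lin (V W Z : normedModType R) k (U : set V) 
    (f : V -> W) (g : {linear W -> Z}) : continuous g -> open U ->
  ck k U f -> ck k U (fun x => g (f x)).
Proof.
move=> cg oU; elim: k f => [|k IH] f /=.
  by move=> cf x Ux; apply: continuous_comp; [exact: cf|exact: cg].
have dg y : differentiable g y by exact: linear_differentiable.
move=> [df Df]; split => [x Ux|v].
  by apply: (differentiable_comp (df _ Ux)).
apply: (@ck_ext _ _ k U (fun x => g ('D_v f x))) => //; last exact: IH.
move=> x Ux; have dfx := df _ Ux.
rewrite [RHS]deriveE; last exact: (differentiable_comp dfx (dg _)).
by rewrite (diff_comp dfx (dg _)) /= diff_lin // deriveE.
Qed.

Lemma ckM (V : normedModType R) k (U : set V) (f g : V -> R) : open U ->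
  ck k U f -> ck k U g -> ck k U (fun x => f x * g x).
Proof.
move=> oU; elim: k f g => [|k IH] f g.
  by move=> /= cf cg x Ux; apply: continuousM; [exact: cf|exact: cg].
move=> Cf Cg; have [[df Df] [dg Dg]] := (Cf, Cg); split => [x Ux|v].
  by have dfx := df _ Ux; have dgx := dg _ Ux; exact: (differentiableM dfx dgx).
apply: (@ck_ext _ _ k U (fun x => f x * 'D_v g x + g x * 'D_v f x)) => //.
  move=> x Ux; have dfx := df _ Ux; have dgx := dg _ Ux.
  by rewrite deriveM //; exact: diff_derivable.
apply: ckD => //; apply: IH; [exact: ckW Cf|exact: Dg|exact: ckW Cg|exact: Df].
Qed.

Lemma ckZl (V W : normedModType R) k (U : set V) (f : V -> R) (w : W) : open U ->
  ck k U f -> ck k U (fun x => f x *: w).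
Proof.
move=> oU; have lin_scal : linear (fun a : R => a *: w).
  by move=> a b c; rewrite scalerDl scalerA.
pose s : {linear R -> W} :=
  HB.pack (fun a : R => a *: w) (GRing.isLinear.Build _ _ _ _ _ lin_scal).
apply: (@ck_lin _ _ _ k U f s) => //; exact: scalel_continuous.
Qed.

Lemma deriveEsum (V W : normedModType R) n (e : 'I_n -> V)
    (phi : 'I_n -> {linear V -> R}) (f : V -> W) x v :
  (forall v, v = \sum_i phi i v *: e i) -> differentiable f x ->
  'D_v f x = \sum_i phi i v *: 'D_(e i) f x.
Proof.
move=> vE df; rewrite deriveE // [v in LHS]vE linear_sum; apply: eq_bigr => i _.
by rewrite linearZ /= deriveE.
Qed.

Lemma ckZ (V W : normedModType R) k (U : set V) (f : V -> R) (g : V -> W) :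
  findim W -> open U -> ck k U f -> ck k U g -> ck k U (fun x => f x *: g x).
Proof.
move=> [n [e [phi [cphi vE]]]] oU cf cg.
apply: (@ck_ext _ _ k U (fun x => \sum_i (f x * phi i (g x)) *: e i)) => //.
  by move=> x _; rewrite [g x in RHS]vE scaler_sumr;
    under [RHS]eq_bigr do rewrite scalerA.
by apply: ck_sum => // i; apply: ckZl => //; apply: ckM => //; exact: ck_lin.
Qed.

(** The chain rule differentiates [g] in the direction ['D_v f x], which varies with [x], whereas
    [ck] speaks of fixed directions. Expanding in the [e i] gives a sum of products of coordinates
    of ['D_v f] with composites of partial derivatives of [g], so the induction on [k] runs over all
    [g] at once. *)
Lemma ck_comp (V W Z : normedModType R) k (U : set V) (O : set W) (f : V -> W)
    (g : W -> Z) : findim W -> findim Z -> open U -> open O ->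
  U `<=` f @^-1` O -> ck k U f -> ck k O g -> ck k U (fun x => g (f x)).
Proof.
move=> [n [e [phi [cphi vE]]]] fZ oU oO fUO.
elim: k f fUO g => [|k IH] f fUO g.
  by move=> /= cf cg x Ux; apply: continuous_comp; [exact: cf|exact/cg/fUO].
move=> Cf [dg Dg]; have [df Df] := Cf; split => [x Ux|v].
  by apply: (differentiable_comp (df _ Ux)); exact/dg/fUO.
apply: (@ck_ext _ _ k U
    (fun x => \sum_i phi i ('D_v f x) *: 'D_(e i) g (f x))) => //.
  move=> x Ux; rewrite -(deriveEsum _ vE); last exact/dg/fUO.
  have dfx := df _ Ux; have dgx := dg _ (fUO _ Ux).
  rewrite [RHS]deriveE; last exact: (differentiable_comp dfx dgx).
  by rewrite (diff_comp dfx dgx) !deriveE.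
apply: ck_sum => // i; apply: ckZ => //; first exact: (ck_lin (cphi i) oU (Df v)).
by apply: (IH f fUO (fun y => 'D_(e i) g y)); [exact: ckW Cf|exact: Dg].
Qed.

Lemma ck_pair (V W Z : normedModType R) k (U : set V) (f : V -> W) (g : V -> Z) :
  open U -> ck k U f -> ck k U g -> ck k U (fun x => (f x, g x)).
Proof.
move=> oU; elim: k f g => [|k IH] f g /=.
  by move=> cf cg x Ux; apply: cvg_pair; [exact: cf|exact: cg].
move=> [df Df] [dg Dg]; split => [x Ux|v].
  by apply: differentiable_pair; [exact: df|exact: dg].
apply: (@ck_ext _ _ k U (fun x => ('D_v f x, 'D_v g x))) => //; last exact: IH.
move=> x Ux; have dfx := df _ Ux; have dgx := dg _ Ux.
rewrite [RHS]deriveE; last exact: differentiable_pair.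
by rewrite diff_pair // !deriveE.
Qed.

End SmoothCalculusTheory.

(** * Smoothness near a point *)

Section SmoothGerms.
Context {R : realType}.

Lemma cinfty_continuous (V W : normedModType R) (f : V -> W) x :
  cinfty_near f x -> {for x, continuous f}.
Proof. by move=> [U [[_ Ux] /(_ 0%N)]]; exact. Qed.

Lemma cinfty_differentiable (V W : normedModType R) (f : V -> W) x :
  cinfty_near f x -> differentiable f x.
Proof. by move=> [U [[_ Ux] /(_ 1%N)]] [+ _]; exact. Qed.

Lemma cinfty_nbhs (V W : normedModType R) (f : V -> W) x :
  cinfty_near f x -> \forall y \near x, cinfty_near f y.
Proof.
move=> [U [[oU Ux] cf]]; apply: filterS (open_nbhs_nbhs (conj oU Ux)) => y Uy.
by exists U.
Qed.

Lemma cinfty_ext (V W : normedModType R) (f g : V -> W) x :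
  (\forall y \near x, f y = g y) -> cinfty_near f x -> cinfty_near g x.
Proof.
rewrite /prop_near1 nbhsE => -[B [oB Ox] fg] [U [[oU Ux] cf]].
exists (U `&` B); split; first by split => //; exact: openI.
move=> k; apply: ck_ext (ck_subset _ (cf k)); first exact: openI.
- by move=> y [_ /fg].
- by move=> y [].
Qed.

Lemma cinfty_comp (V W Z : normedModType R) (f : V -> W) (g : W -> Z) x :
  findim W -> findim Z -> cinfty_near f x -> cinfty_near g (f x) ->
  cinfty_near (fun y => g (f y)) x.
Proof.
move=> fW fZ cf; have fx := cinfty_continuous cf.
case: cf => [U [[oU Ux] cf]] [B [[oB Ofx] cg]].
have Ofn : nbhs x (f @^-1` B) by apply: fx; exact: open_nbhs_nbhs.
exists (U `&` (f @^-1` B)°); split.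
  by split; [apply: openI => //; exact: open_interior|split].
move=> k; apply: (@ck_comp _ _ _ _ k _ B) => //.
- by apply: openI => //; exact: open_interior.
- by move=> y [_ /interior_subset].
- by apply: ck_subset (cf k) => y [].
Qed.

Lemma cinfty_lin (V W : normedModType R) (g : {linear V -> W}) x :
  continuous g -> cinfty_near g x.
Proof.
move=> cg; exists setT; split; first by split => //; exact: openT.
elim=> [|k IH] /=; first by move=> *; exact: cg.
split => [y _|v]; first exact: linear_differentiable.
have -> : (fun y => 'D_v g y) = cst (g v).
  apply/funext => y; rewrite deriveE; last exact: linear_differentiable.
  by rewrite diff_lin.
exact: ck_cst.
Qed.

Lemma cinfty_id (V : normedModType R) (x : V) : cinfty_near id x.
Proof. by apply: (@cinfty_lin _ _ idfun) => y. Qed.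

Lemma cinfty_cst (V W : normedModType R) (w : W) (x : V) :
  cinfty_near (fun=> w) x.
Proof.
exists setT; split; first by split => //; exact: openT.
by move=> k; exact: ck_cst.
Qed.

Lemma cinfty_fst (V W : normedModType R) (x : (V * W)%type) :
  cinfty_near (fun p : (V * W)%type => p.1) x.
Proof. by apply: (@cinfty_lin _ _ fst) => y; exact: cvg_fst. Qed.

Lemma cinfty_snd (V W : normedModType R) (x : (V * W)%type) :
  cinfty_near (fun p : (V * W)%type => p.2) x.
Proof. by apply: (@cinfty_lin _ _ snd) => y; exact: cvg_snd. Qed.

Lemma cinfty_pair (V W Z : normedModType R) (f : V -> W) (g : V -> Z) x :
  cinfty_near f x -> cinfty_near g x -> cinfty_near (fun y => (f y, g y)) x.
Proof.
move=> [U [[oU Ux] cf]] [B [[oB Ox] cg]]; exists (U `&` B); split.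
  by split; [exact: openI|].
move=> k; apply: ck_pair; first exact: openI.
- by apply: ck_subset (cf k) => y [].
- by apply: ck_subset (cg k) => y [].
Qed.

Lemma cinftyD (V W : normedModType R) (f g : V -> W) x :
  cinfty_near f x -> cinfty_near g x -> cinfty_near (fun y => f y + g y) x.
Proof.
move=> [U [[oU Ux] cf]] [B [[oB Ox] cg]]; exists (U `&` B); split.
  by split; [exact: openI|].
move=> k; apply: ckD; first exact: openI.
- by apply: ck_subset (cf k) => y [].
- by apply: ck_subset (cg k) => y [].
Qed.

Lemma cinftyZl (V W : normedModType R) (f : V -> R) (w : W) x :
  cinfty_near f x -> cinfty_near (fun y => f y *: w) x.
Proof.
move=> [U [oU cf]]; exists U; split => // k.
by apply: ckZl; [case: oU|exact: cf].
Qed.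

Lemma cinfty_derive (V W : normedModType R) (f : V -> W) v x :
  cinfty_near f x -> cinfty_near (fun y => 'D_v f y) x.
Proof.
by move=> [U [oU cf]]; exists U; split => // k; have [_] := cf k.+1; exact.
Qed.

End SmoothGerms.

(** * Smooth maps between spaces with charts *)

Section ChartedTheory.
Context {R : realType}.
Implicit Types X Y Z : charted R.

(* The part of the manifold axioms that is stable under finite products and
   holds for model spaces. *)
Record good X : Prop := Good {
  good_cover : forall x : X, exists2 c, charts c & chart_dom c x;
  good_open : forall c, @charts R X c -> open (chart_dom c);
  good_img : forall c, @charts R X c -> forall x, chart_dom c x ->
    \forall z \near chart_to c x,
      chart_dom c (chart_from c z) /\ chart_to c (chart_from c z) = z;
  good_toK : forall c, @charts R X c -> forall x, chart_dom c x ->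
    chart_from c (chart_to c x) = x;
  good_to : forall c, @charts R X c -> forall x, chart_dom c x ->
    {for x, continuous (chart_to c)};
  good_from : forall c, @charts R X c -> forall x, chart_dom c x ->
    {for chart_to c x, continuous (chart_from c)};
  good_compat : forall c d, @charts R X c -> charts d ->
    forall x, chart_dom c x -> chart_dom d x ->
    cinfty_near (fun z => chart_to d (chart_from c z)) (chart_to c x);
  good_findim : findim (charted_model X) }.

Lemma good_model (V : normedModType R) : findim V -> good (model_charted V).
Proof.
move=> fV; split => //=.
- by move=> x; exists (Chart setT id id).
- by move=> _ -> /=; exact: openT.
- by move=> _ -> /= x _; apply: filterE.
- by move=> _ ->.
- by move=> _ -> /= x _ P.
- by move=> _ -> /= x _ P.
- by move=> _ _ -> -> /= x _ _; exact: cinfty_id.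
Qed.

Lemma good_manifold n (M : manifold R n) : good M.
Proof.
split; try by [case: M|exact: findim_rV].
move=> c /= cM x xc.
have img : nbhs (chart_to c x) (chart_to c @` chart_dom c).
  by apply: open_nbhs_nbhs; split; [exact: (atlas_img_open cM)|exists x].
by apply: filterS img => _ [y yc <-]; rewrite (atlas_toK cM yc).
Qed.

Lemma good_prod X Y : good X -> good Y -> good (prod_charted X Y).
Proof.
move=> gX gY; split => /=.
- move=> [x y]; have [c cX cx] := good_cover gX x.
  have [d dY dy] := good_cover gY y.
  by exists (prod_chart c d) => //=; exists c, d.
- move=> _ [c [d [cX dY ->]]] /=.
  rewrite openE => -[x y] [/= xc yd]; exists (chart_dom c, chart_dom d) => //=.
  by split; apply: open_nbhs_nbhs; split => //;
    [exact: (good_open gX)|exact: (good_open gY)].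
- move=> _ [c [d [cX dY ->]]] [x y] [/= xc yd].
  have Hx := good_img gX cX xc; have Hy := good_img gY dY yd.
  exists ([set z | chart_dom c (chart_from c z) /\ chart_to c (chart_from c z) = z],
    [set z | chart_dom d (chart_from d z) /\ chart_to d (chart_from d z) = z]) => //.
  by move=> [z w] [/= [? ->] [? ->]].
- move=> _ [c [d [cX dY ->]]] [x y] [/= xc yd].
  by rewrite (good_toK gX cX xc) (good_toK gY dY yd).
- move=> _ [c [d [cX dY ->]]] [x y] [/= xc yd].
  apply: cvg_pair => /=.
    apply: (@cvg_comp _ _ _ fst (chart_to c)); first exact: cvg_fst.
    exact: (good_to gX cX).
  apply: (@cvg_comp _ _ _ snd (chart_to d)); first exact: cvg_snd.
  exact: (good_to gY dY).
- move=> _ [c [d [cX dY ->]]] [x y] [/= xc yd].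
  apply: cvg_pair => /=.
    apply: (@cvg_comp _ _ _ fst (chart_from c)); first exact: cvg_fst.
    exact: (good_from gX cX).
  apply: (@cvg_comp _ _ _ snd (chart_from d)); first exact: cvg_snd.
  exact: (good_from gY dY).
- move=> _ _ [c [d [cX dY ->]]] [c' [d' [cX' dY' ->]]] [x y] /= [/= xc yd] [xc' yd'].
  have fX := good_findim gX; have fY := good_findim gY.
  apply: cinfty_pair.
    apply: (@cinfty_comp _ _ _ _ fst (fun z => chart_to c' (chart_from c z))) => //.
      exact: cinfty_fst.
    exact: (good_compat gX).
  apply: (@cinfty_comp _ _ _ _ snd (fun z => chart_to d' (chart_from d z))) => //.
    exact: cinfty_snd.
  exact: (good_compat gY).
- by apply: findim_prod; exact: good_findim.
Qed.

Lemma chart_from_near X c (x : X) (P : set X) : good X -> charts c ->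
  chart_dom c x -> (\forall y \near x, P y) ->
  \forall z \near chart_to c x, P (chart_from c z).
Proof.
move=> gX cX xc Px; apply: (good_from gX cX xc).
by rewrite /= (good_toK gX cX xc).
Qed.

Lemma chart_dom_near X c (x : X) : good X -> charts c -> chart_dom c x ->
  \forall y \near x, chart_dom c y.
Proof. by move=> gX cX xc; apply: open_nbhs_nbhs; split; [exact: good_open|]. Qed.

(** In any other pair of charts the expression of [f] is, near the point, the given one between two
    transition maps; hence a single pair suffices. *)
Lemma smooth_atP X Y (f : X -> Y) x c d : good X -> good Y ->
  charts c -> charts d -> chart_dom c x -> chart_dom d (f x) ->
  {for x, continuous f} ->
  cinfty_near (fun z => chart_to d (f (chart_from c z))) (chart_to c x) ->
  smooth_at f x.
Proof.
move=> gX gY cX dY xc fxd cf Hf; split => // c' d' cX' dY' xc' fxd'.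
have fX := good_findim gX; have fY := good_findim gY.
pose t z := chart_to c (chart_from c' z).
pose F z := chart_to d (f (chart_from c z)).
pose t' z := chart_to d' (chart_from d z).
have tx : t (chart_to c' x) = chart_to c x by rewrite /t (good_toK gX cX').
have Fx : F (chart_to c x) = chart_to d (f x) by rewrite /F (good_toK gX cX).
apply: (@cinfty_ext _ _ _ (fun z => t' (F (t z)))).
  have n1 : \forall y \near x, chart_dom c y /\ chart_dom d (f y).
    near=> y; split; near: y; first exact: chart_dom_near.
    by apply: cf; exact: chart_dom_near.
  apply: filterS (chart_from_near gX cX' xc' n1) => z [z1 z2].
  by rewrite /t' /F /t (good_toK gX cX z1) (good_toK gY dY z2).
apply: (cinfty_comp fY fY).
  apply: (cinfty_comp fX fY); first exact: good_compat.
  by rewrite tx.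
by rewrite tx Fx; exact: good_compat.
Unshelve. all: by end_near. Qed.

Lemma smooth_continuous X Y (f : X -> Y) x :
  smooth_at f x -> {for x, continuous f}.
Proof. by case. Qed.

Lemma smooth_comp X Y Z (f : X -> Y) (g : Y -> Z) x :
  good X -> good Y -> good Z ->
  smooth_at f x -> smooth_at g (f x) -> smooth_at (fun y => g (f y)) x.
Proof.
move=> gX gY gZ [cf Hf] [cg Hg].
have [c cX xc] := good_cover gX x; have [d dY yd] := good_cover gY (f x).
have [e eZ ze] := good_cover gZ (g (f x)).
have fX := good_findim gX; have fY := good_findim gY; have fZ := good_findim gZ.
apply: (@smooth_atP X Z _ x c e) => //; first exact: continuous_comp.
apply: (@cinfty_ext _ _ _ (fun z => chart_to e (g (chart_from d
   (chart_to d (f (chart_from c z))))))).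
  have n1 : \forall y \near x, chart_dom d (f y).
    by apply: cf; exact: chart_dom_near.
  by apply: filterS (chart_from_near gX cX xc n1) => z zd; rewrite (good_toK gY).
apply: (@cinfty_comp _ _ _ _ (fun z => chart_to d (f (chart_from c z)))
   (fun w => chart_to e (g (chart_from d w)))) => //.
  exact: Hf.
by rewrite (good_toK gX cX xc); exact: Hg.
Qed.

Lemma smooth_ext X Y (f g : X -> Y) x : good X ->
  (\forall y \near x, f y = g y) -> smooth_at f x -> smooth_at g x.
Proof.
move=> gX fg [cf Hf]; have fgx := nbhs_singleton fg; split.
  rewrite /prop_for /continuous_at -fgx.
  exact: cvg_trans (near_eq_cvg fg) cf.
move=> c d cX dY xc; rewrite -fgx => fxd.
apply: cinfty_ext (Hf c d cX dY xc fxd).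
by apply: filterS (chart_from_near gX cX xc fg) => z ->.
Qed.

Lemma smooth_id X (x : X) : good X -> smooth_at id x.
Proof. by move=> gX; split => [P //|c d cX dX xc xd]; exact: good_compat. Qed.

Lemma smooth_cst X Y (x : X) (y : Y) : smooth_at (fun=> y) x.
Proof. by split => [|c d *]; [exact: cst_continuous|exact: cinfty_cst]. Qed.

Lemma smooth_fst X Y (p : prod_charted X Y) : good X -> good Y ->
  @smooth_at R (prod_charted X Y) X (fun q => q.1) p.
Proof.
move=> gX gY; have [c cX xc] := good_cover gX p.1.
have [d dY yd] := good_cover gY p.2.
apply: (@smooth_atP (prod_charted X Y) X _ _ (prod_chart c d) c) => //.
- exact: good_prod.
- by exists c, d.
- exact: cvg_fst.
- apply: (@cinfty_ext _ _ _ (fun z => z.1)); last exact: cinfty_fst.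
  have H := good_img gX cX xc.
  exists ([set z | chart_dom c (chart_from c z) /\ chart_to c (chart_from c z) = z],
    setT) => /=.
    by split => //; exact: filterT.
  by move=> [z w] [/= ? ?]; intuition.
Qed.

Lemma smooth_snd X Y (p : prod_charted X Y) : good X -> good Y ->
  @smooth_at R (prod_charted X Y) Y (fun q => q.2) p.
Proof.
move=> gX gY; have [c cX xc] := good_cover gX p.1.
have [d dY yd] := good_cover gY p.2.
apply: (@smooth_atP (prod_charted X Y) Y _ _ (prod_chart c d) d) => //.
- exact: good_prod.
- by exists c, d.
- exact: cvg_snd.
- apply: (@cinfty_ext _ _ _ (fun z => z.2)); last exact: cinfty_snd.
  have H := good_img gY dY yd.
  exists (setT,
    [set z | chart_dom d (chart_from d z) /\ chart_to d (chart_from d z) = z]) => /=.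
    by split => //; exact: filterT.
  by move=> [z w] [/= ? ?]; intuition.
Qed.

Lemma smooth_pair X Y Z (f : X -> Y) (g : X -> Z) x : 
  smooth_at f x -> smooth_at g x ->
  @smooth_at R X (prod_charted Y Z) (fun y => (f y, g y)) x.
Proof.
move=> [cf Hf] [cg Hg]; split; first by apply: cvg_pair.
move=> c _ cX [d [e [dY eZ ->]]] xc [/= fxd gxe].
by apply: cinfty_pair; [exact: Hf|exact: Hg].
Qed.

Lemma smooth2_comp (W : charted R) X Y Z (F : X -> Y -> Z) (f : W -> X) (g : W -> Y) w :
  good W -> good X -> good Y -> good Z ->
  smooth2_at F (f w) (g w) -> smooth_at f w -> smooth_at g w ->
  smooth_at (fun v => F (f v) (g v)) w.
Proof.
move=> gW gX gY gZ HF Hf Hg.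
apply: (@smooth_comp W (prod_charted X Y) Z (fun v => (f v, g v))
  (fun p => F p.1 p.2) w gW (good_prod gX gY) gZ) => //.
exact: smooth_pair.
Qed.

Lemma smooth_comp_fst X Y Z (f : X -> Z) (x : X) (y : Y) :
  good X -> good Y -> good Z -> smooth_at f x ->
  @smooth_at R (prod_charted X Y) Z (fun p => f p.1) (x, y).
Proof.
move=> gX gY gZ sf; have gXY := good_prod gX gY.
exact: (@smooth_comp (prod_charted X Y) X Z (fun p => p.1) f (x, y) gXY gX gZ
  (smooth_fst _ gX gY) sf).
Qed.

Lemma smooth_comp_snd X Y Z (f : Y -> Z) (x : X) (y : Y) :
  good X -> good Y -> good Z -> smooth_at f y ->
  @smooth_at R (prod_charted X Y) Z (fun p => f p.2) (x, y).
Proof.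
move=> gX gY gZ sf; have gXY := good_prod gX gY.
exact: (@smooth_comp (prod_charted X Y) Y Z (fun p => p.2) f (x, y) gXY gY gZ
  (smooth_snd _ gX gY) sf).
Qed.

Lemma smooth2_at_comp X X' Y Y' Z (F : X' -> Y' -> Z) (f : X -> X') (g : Y -> Y') x y :
  good X -> good Y -> good X' -> good Y' -> good Z ->
  smooth2_at F (f x) (g y) -> smooth_at f x -> smooth_at g y ->
  smooth2_at (fun x y => F (f x) (g y)) x y.
Proof.
move=> gX gY gX' gY' gZ sF sf sg; have gXY := good_prod gX gY.
exact: (@smooth2_comp (prod_charted X Y) X' Y' Z F (fun p => f p.1) (fun p => g p.2)
  (x, y) gXY gX' gY' gZ sF (smooth_comp_fst y gX gY gX' sf)
  (smooth_comp_snd x gX gY gY' sg)).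
Qed.

Lemma smooth2_at_post X Y Z Z' (F : X -> Y -> Z) (f : Z -> Z') x y :
  good X -> good Y -> good Z -> good Z' ->
  smooth2_at F x y -> smooth_at f (F x y) -> smooth2_at (fun x y => f (F x y)) x y.
Proof.
move=> gX gY gZ gZ' sF sf; have gXY := good_prod gX gY.
exact: (@smooth_comp (prod_charted X Y) Z Z' (fun p => F p.1 p.2) f (x, y)).
Qed.

Lemma smooth_modelE (V W : normedModType R) (f : V -> W) x :
  @smooth_at R (model_charted V) (model_charted W) f x <-> cinfty_near f x.
Proof.
split=> [[_ H]|H]; first exact: (H (Chart setT id id) (Chart setT id id)).
by split => [|_ _ -> ->] //; exact: cinfty_continuous.
Qed.

Lemma smooth_chart_to X c (x : X) : good X -> charts c -> chart_dom c x ->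
  @smooth_at R X (model_charted (charted_model X)) (chart_to c) x.
Proof.
move=> gX cX xc; split => [|c' _ cX' -> /= xc' _]; first exact: (good_to gX).
exact: (good_compat gX).
Qed.

Lemma smooth_chart_from X c (x : X) : good X -> charts c -> chart_dom c x ->
  @smooth_at R (model_charted (charted_model X)) X (chart_from c) (chart_to c x).
Proof.
move=> gX cX xc; split => [|_ d -> dX _ /=]; first exact: (good_from gX).
by rewrite (good_toK gX cX xc) => xd; exact: (good_compat gX).
Qed.

(** [cinfty_near] is an open condition and already contains continuity, so near [x] the map is
    recovered as its smooth chart expression after the chart. Its main use is to remove the
    smoothness guard of tangent vectors at neighbouring points. *)
Lemma smooth_nbhs X (W : normedModType R) (f : X -> W) x : good X -> findim W ->
  @smooth_at R X (model_charted W) f x ->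
  \forall y \near x, @smooth_at R X (model_charted W) f y.
Proof.
move=> gX fW [cf Hf]; have [c cX xc] := good_cover gX x.
have := Hf c (Chart setT id id) cX erefl xc I => /= /cinfty_nbhs cn.
have xn : \forall y \near x, cinfty_near (fun z => f (chart_from c z)) (chart_to c y).
  exact: (good_to gX cX xc).
near=> y; have yc : chart_dom c y by near: y; exact: chart_dom_near.
have yn : cinfty_near (fun z => f (chart_from c z)) (chart_to c y) by near: y.
apply: (@smooth_ext X (model_charted W) (fun y => f (chart_from c (chart_to c y)))) => //.
  by near do rewrite (good_toK gX cX) //; exact: chart_dom_near.
apply: (@smooth_comp X (model_charted (charted_model X)) (model_charted W)
  (chart_to c) (fun z => f (chart_from c z))) => //.
- exact/good_model/good_findim.
- exact: good_model.
- exact: smooth_chart_to.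
- exact/smooth_modelE.
Unshelve. all: by end_near. Qed.

End ChartedTheory.

(** * Tangent vectors *)

Section TangentTheory.
Context {R : realType}.
Implicit Types X Y Z : charted R.

Lemma good_real : good (realline R).
Proof. exact/good_model/findim_real. Qed.

Lemma good_euclid n : good (euclid R n).
Proof. exact/good_model/findim_rV. Qed.

Hint Resolve good_real good_euclid : core.

Lemma derive_comp (U V W : normedModType R) (f : U -> V) (g : V -> W) x v :
  differentiable f x -> differentiable g (f x) ->
  'D_v (fun y => g (f y)) x = 'D_('D_v f x) g (f x).
Proof.
move=> df dg; rewrite [LHS]deriveE; last exact: (differentiable_comp df dg).
by rewrite (diff_comp df dg) /= !deriveE.
Qed.

Lemma smooth_fun_chart X (f : X -> R) x c : smooth_fun_at f x ->
  charts c -> chart_dom c x ->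
  cinfty_near (fun z => f (chart_from c z)) (chart_to c x).
Proof. by move=> [_ /(_ c (Chart setT id id))] H cX xc; exact: H. Qed.

Lemma smooth_curve_chart X (u : R -> X) c : smooth_curve u ->
  charts c -> chart_dom c (u 0) ->
  cinfty_near (fun t : R => chart_to c (u t)) (0 : R).
Proof.
by move=> [_ /(_ (Chart setT id id) c)] H cX xc; exact: (H erefl cX I xc).
Qed.

(* By the chain rule in the chart c, the velocities of the curves through x are
   exactly these derivations; this is what makes tangent x a vector space. *)
Definition dvec X (c : chart X (charted_model X)) (x : X)
    (w : charted_model X) : tvec X := fun f =>
  if `[< smooth_fun_at f x >]
  then 'D_w (fun z => f (chart_from c z)) (chart_to c x) else 0.

Lemma velocityE X (u : R -> X) c : good X -> smooth_curve u ->
  charts c -> chart_dom c (u 0) ->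
  velocity u = dvec c (u 0) ('D_1 (fun t : R => chart_to c (u t)) (0 : R)).
Proof.
move=> gX su cX uc; apply/funext => f; rewrite /velocity /dvec.
case: asboolP => // sf; rewrite derive1E.
have Hu := smooth_curve_chart su cX uc; have Hf := smooth_fun_chart sf cX uc.
transitivity ('D_1 (fun t : R => f (chart_from c (chart_to c (u t)))) (0 : R)).
  apply: near_eq_derive.
  have : \forall t \near (0 : R), chart_dom c (u t).
    by apply: (smooth_continuous su); exact: chart_dom_near.
  by apply: filterS => t tc; rewrite (good_toK gX cX tc).
exact: (@derive_comp _ _ _ (fun t : R => chart_to c (u t))
  (fun z => f (chart_from c z)) 0 1 
  (cinfty_differentiable Hu) (cinfty_differentiable Hf)).
Qed.

Lemma derive_line (V : normedModType R) (z w : V) (t : R) :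
  'D_1 (fun t : R => z + t *: w) t = w.
Proof.
have ds : is_diff t ( *:%R ^~ w) ( *:%R ^~ w) by exact: is_diff_scalel.
rewrite deriveD; [|exact: derivable_cst|exact/diff_derivable/ex_diff].
rewrite derive_cst add0r deriveE; last exact: ex_diff.
by rewrite diff_val scale1r.
Qed.

Lemma derive_pair (V W Z : normedModType R) (f : V -> W) (g : V -> Z) x v :
  differentiable f x -> differentiable g x ->
  'D_v (fun y => (f y, g y)) x = ('D_v f x, 'D_v g x).
Proof.
move=> df dg; rewrite deriveE; last exact: differentiable_pair.
by rewrite diff_pair // !deriveE.
Qed.

Lemma cinfty_line (V : normedModType R) (z w : V) (t : R) :
  cinfty_near (fun t : R => z + t *: w) t.
Proof. by apply: cinftyD; [exact: cinfty_cst|apply: cinftyZl; exact: cinfty_id]. Qed.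

(** The curve is a straight line in the chart; it provides the inclusion of [range (dvec c x)] in
    the tangent space. *)
Lemma chart_line X c (x : X) (w : charted_model X) :
  good X -> charts c -> chart_dom c x ->
  exists u : R -> X, [/\ smooth_curve u, u 0 = x & velocity u = dvec c x w].
Proof.
move=> gX cX xc; pose l (t : R) := chart_to c x + t *: w.
have l0 : l 0 = chart_to c x by rewrite /l scale0r addr0.
have cl : cinfty_near l (0 : R) by exact: cinfty_line.
have u0 : chart_from c (l 0) = x by rewrite l0 (good_toK gX cX).
have su : smooth_curve (fun t => chart_from c (l t)).
  apply: (@smooth_comp _ (realline R) (model_charted (charted_model X)) X
    l (chart_from c)) => //.
  - exact: good_model (good_findim gX).
  - exact/smooth_modelE.
  - by rewrite l0; exact: smooth_chart_from.
exists (fun t => chart_from c (l t)); split => //.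
rewrite (@velocityE X _ c) // u0 //.
rewrite (@near_eq_derive _ _ _ _ l) ?derive_line //.
have cl0 : l t @[t --> (0 : R)] --> l 0 := cinfty_continuous cl.
have := good_img gX cX xc; rewrite -l0 => lc.
have lc' : \forall t \near (0 : R), chart_dom c (chart_from c (l t)) /\
  chart_to c (chart_from c (l t)) = l t := cl0 _ lc.
by apply: filterS lc' => t [].
Qed.

Lemma tangentE X c (x : X) : good X -> charts c -> chart_dom c x ->
  tangent x = range (dvec c x).
Proof.
move=> gX cX xc; rewrite eqEsubset; split => [_ [u [su u0 ->]]|_ [w _ <-]].
  subst x; rewrite (velocityE gX su cX xc).
  by exists ('D_1 (fun t : R => chart_to c (u t)) (0 : R)).
by have [u [su u0 <-]] := chart_line w gX cX xc; exists u.
Qed.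

Lemma dvecP X c (x : X) a v w : charts c -> chart_dom c x ->
  dvec c x (a *: v + w) = a *: dvec c x v + dvec c x w.
Proof.
move=> cX xc; apply/funext => f.
rewrite /dvec -[RHS]/(a * dvec c x v f + dvec c x w f) /dvec.
case: asboolP => [sf|_]; last by rewrite mulr0 addr0.
have Hf := cinfty_differentiable (smooth_fun_chart sf cX xc).
by rewrite !deriveE // linearP.
Qed.

(** Tested on the coordinate function [phi i] read through the chart, the derivation returns the
    coordinate [phi i w]. *)
Lemma dvec_inj X c (x : X) w : good X -> charts c -> chart_dom c x ->
  dvec c x w = 0 -> w = 0.
Proof.
move=> gX cX xc d0; have [n [e [phi [cphi wE]]]] := good_findim gX.
rewrite (wE w) big1 // => i _.
have sphi : smooth_fun_at (fun y => phi i (chart_to c y)) x.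
  apply: (@smooth_comp _ X (model_charted (charted_model X)) (realline R)
    (chart_to c) (phi i)) => //.
  - exact: good_model (good_findim gX).
  - exact: smooth_chart_to.
  - by apply/smooth_modelE; exact: cinfty_lin.
have := congr1 (fun D : tvec X => D (fun y => phi i (chart_to c y))) d0.
rewrite /dvec asboolT //; rewrite (@near_eq_derive _ _ _ _ (phi i)).
  rewrite deriveE; last exact: linear_differentiable.
  rewrite diff_lin // => ->; exact: scale0r.
by apply: filterS (good_img gX cX xc) => z [_ ->].
Qed.

Lemma tangent_subspace X (x : X) : good X -> vsubspace (tangent x).
Proof.
move=> gX; have [c cX xc] := good_cover gX x; rewrite (tangentE gX cX xc).
split=> [|a _ _ [v _ <-] [w _ <-]]; last by exists (a *: v + w) => //; exact: dvecP.
by exists 0 => //; apply/funext => f; rewrite /dvec derive0; case: asboolP.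
Qed.

Lemma tangent_supp X (x : X) D f : tangent x D -> ~ smooth_fun_at f x -> D f = 0.
Proof. by move=> [u [_ <- ->]] nf; rewrite /velocity asboolF. Qed.

Lemma velocity_ext X (u v : R -> X) :
  (\forall t \near (0 : R), u t = v t) -> velocity u = velocity v.
Proof.
move=> uv; have uv0 := nbhs_singleton uv; apply/funext => f.
rewrite /velocity uv0; case: asboolP => // _; rewrite !derive1E.
by apply: near_eq_derive; apply: filterS uv => t ->.
Qed.

Lemma tangent_velocity X (u : R -> X) : smooth_curve u -> tangent (u 0) (velocity u).
Proof. by exists u. Qed.

Section Tmap.
Variables X Y : charted R.
Hypotheses (gX : good X) (gY : good Y).
Implicit Types (phi psi : X -> Y) (x : X) (D E : tvec X).

Lemma smooth_fun_comp phi x (f : Y -> R) : smooth_at phi x ->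
  smooth_fun_at f (phi x) -> smooth_fun_at (fun y => f (phi y)) x.
Proof. by move=> sphi sf; exact: (@smooth_comp _ X Y (realline R) phi f). Qed.

Lemma smooth_curve_comp phi (u : R -> X) : smooth_curve u ->
  smooth_at phi (u 0) -> smooth_curve (fun t => phi (u t)).
Proof. by move=> su sphi; exact: (@smooth_comp _ (realline R) X Y u phi). Qed.

Lemma tmap_velocity phi (u : R -> X) : smooth_at phi (u 0) ->
  tmap phi (u 0) (velocity u) = velocity (fun t => phi (u t)).
Proof.
move=> sphi; apply/funext => f; rewrite /tmap /velocity.
by case: asboolP => // sf; rewrite asboolT //; exact: smooth_fun_comp.
Qed.

Lemma tmap_tangent phi x D : smooth_at phi x -> tangent x D ->
  tangent (phi x) (tmap phi x D).
Proof.
move=> sphi [u [su u0 ->]]; subst x; rewrite tmap_velocity //.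
exact/(@tangent_velocity Y (fun t => phi (u t)))/smooth_curve_comp.
Qed.

Lemma tmapP phi x a D E : tmap phi x (a *: D + E) = a *: tmap phi x D + tmap phi x E.
Proof.
apply/funext => f; rewrite -[RHS]/(a * tmap phi x D f + tmap phi x E f) /tmap.
by case: asboolP => // _; rewrite mulr0 addr0.
Qed.

Lemma tmap0 phi x : tmap phi x 0 = 0.
Proof. by apply/funext => f; rewrite /tmap; case: asboolP. Qed.

Lemma tmapD phi x D E : tmap phi x (D + E) = tmap phi x D + tmap phi x E.
Proof. by rewrite -[D]scale1r tmapP !scale1r. Qed.

Lemma tmapB phi x D E : tmap phi x (D - E) = tmap phi x D - tmap phi x E.
Proof. by rewrite addrC -scaleN1r tmapP scaleN1r addrC. Qed.

(** An arbitrary operator need not be local; a tangent vector is, being the velocity of a curve,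
    which stays where the two maps agree. *)
Lemma tmap_ext phi psi x D : tangent x D -> smooth_at phi x ->
  (\forall y \near x, phi y = psi y) -> tmap phi x D = tmap psi x D.
Proof.
move=> [u [su u0 ->]] sphi pp; subst x; rewrite !tmap_velocity //.
  by apply: velocity_ext; exact: (smooth_continuous su pp).
exact: smooth_ext pp sphi.
Qed.

End Tmap.

Lemma tmap_comp X Y Z (phi : X -> Y) (psi : Y -> Z) x D :
  good X -> good Y -> good Z -> smooth_at psi (phi x) ->
  tmap psi (phi x) (tmap phi x D) = tmap (fun y => psi (phi y)) x D.
Proof.
move=> gX gY gZ spsi; apply/funext => f; rewrite /tmap.
by case: asboolP => // sf; rewrite asboolT //; exact: (smooth_fun_comp gY gZ).
Qed.

Lemma tmap_id X (x : X) D : tangent x D -> tmap id x D = D.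
Proof.
move=> xD; apply/funext => f; rewrite /tmap; case: asboolP => // nf.
by rewrite (tangent_supp xD nf).
Qed.

Lemma tmap_cst X Y (x : X) (y : Y) D : tangent x D -> tmap (fun=> y) x D = 0.
Proof.
move=> [u [_ <- ->]]; apply/funext => f; rewrite /tmap; case: asboolP => // _.
rewrite /velocity; case: asboolP => // _.
by rewrite derive1E derive_cst.
Qed.

(** The Leibniz rule: in a product chart the velocity depends linearly on the pair of derivatives,
    and [(a, b) = (a, 0) + (0, b)]. *)
Lemma velocity2 X Y Z (F : X -> Y -> Z) (u : R -> X) (v : R -> Y) :
  good X -> good Y -> good Z -> smooth_curve u -> smooth_curve v ->
  smooth2_at F (u 0) (v 0) ->
  velocity (fun t => F (u t) (v t)) =
  velocity (fun t => F (u t) (v 0)) + velocity (fun t => F (u 0) (v t)).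
Proof.
move=> gX gY gZ su sv sF; have gXY := good_prod gX gY.
have [c cX xc] := good_cover gX (u 0); have [d dY yd] := good_cover gY (v 0).
have eXY : charts (prod_chart c d : chart (prod_charted X Y) _) by exists c, d.
have cu := cinfty_differentiable (smooth_curve_chart su cX xc).
have cv := cinfty_differentiable (smooth_curve_chart sv dY yd).
have sc (W : charted R) (w : W) : @smooth_curve R W (fun=> w) by exact: smooth_cst.
(* This form is applied three times, with either curve replaced by a constant one, always at the
   same point of the product. *)
have key (u' : R -> X) (v' : R -> Y) (p : prod_charted X Y) :
    p = (u 0, v 0) -> smooth_curve u' -> smooth_curve v' ->
    u' 0 = u 0 -> v' 0 = v 0 ->
    velocity (fun t => F (u' t) (v' t)) =
    tmap (fun q : prod_charted X Y => F q.1 q.2) p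
      (dvec (prod_chart c d : chart (prod_charted X Y) _) p
         ('D_1 (fun t : R => chart_to c (u' t)) (0 : R),
          'D_1 (fun t : R => chart_to d (v' t)) (0 : R))).
  move=> -> su' sv' u0 v0.
  have xc' : chart_dom c (u' 0) by rewrite u0.
  have yd' : chart_dom d (v' 0) by rewrite v0.
  have cu' := cinfty_differentiable (smooth_curve_chart su' cX xc').
  have cv' := cinfty_differentiable (smooth_curve_chart sv' dY yd').
  pose w (t : R) : prod_charted X Y := (u' t, v' t).
  have sw : smooth_curve w by exact: smooth_pair.
  rewrite -[LHS]/(velocity (fun t => (fun q : prod_charted X Y => F q.1 q.2) (w t))).
  rewrite -(tmap_velocity gXY gZ); last by rewrite /w u0 v0.
  rewrite (velocityE gXY sw eXY) //.
  have -> : 'D_1 (fun t : R => chart_to (prod_chart c d) (w t)) (0 : R) = _ :=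
    derive_pair (1 : R) cu' cv'.
  by rewrite /w u0 v0.
rewrite (key u v (u 0, v 0)) // (key u (fun=> v 0) (u 0, v 0)) //.
rewrite (key (fun=> u 0) v (u 0, v 0)) // !derive_cst -tmapD.
congr (tmap _ _ _).
set a := 'D_1 (fun t : R => chart_to c (u t)) (0 : R).
set b := 'D_1 (fun t : R => chart_to d (v t)) (0 : R).
have -> : (a, b) = 1 *: (a, 0) + (0, b) :> (charted_model X * charted_model Y)%type.
  by rewrite scale1r; congr (_, _); rewrite /= ?addr0 ?add0r.
by rewrite (@dvecP (prod_charted X Y)) // scale1r.
Qed.

Lemma is_basis_mem (V : lmodType R) (A : set V) n (b : 'I_n -> V) k :
  is_basis A b -> A (b k).
Proof.
move=> [_ ->]; exists (fun i => (i == k)%:R); rewrite (bigD1 k) //= eqxx scale1r.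
by rewrite big1 ?addr0 // => i /negPf ->; rewrite scale0r.
Qed.

(** Linearity and injectivity are asked on [A] only, because [fundamental v] is known to be linear
    only on the Lie algebra. *)
Lemma is_basis_map (V W : lmodType R) (A : set V) (f : V -> W) n (b : 'I_n -> V) :
  vsubspace A ->
  (forall a v w, A v -> A w -> f (a *: v + w) = a *: f v + f w) ->
  (forall v, A v -> f v = 0 -> v = 0) ->
  is_basis A b -> is_basis (f @` A) (f \o b).
Proof.
move=> [A0 AP] fP f0 [bfree bE].
have f00 : f 0 = 0.
  by have := fP (-1) 0 0 A0 A0; rewrite scaler0 addr0 scaleN1r addNr.
have Ab k : A (b k) by exact: is_basis_mem (conj bfree bE).
have fsum (r : seq 'I_n) c : A (\sum_(k <- r) c k *: b k) /\
    f (\sum_(k <- r) c k *: b k) = \sum_(k <- r) c k *: f (b k).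
  elim: r => [|k r [Ar fr]]; first by rewrite !big_nil.
  by rewrite !big_cons; split; [exact: AP|rewrite fP // fr].
split=> [c|].
  have [Ac fc] := fsum (index_enum 'I_n) c.
  by move=> fc0; apply: bfree; apply: f0 => //; rewrite fc.
rewrite eqEsubset; split => [_ [v Av <-]|_ [c ->]].
  move: Av; rewrite bE => -[c ->]; exists c.
  by have [_ fc] := fsum (index_enum 'I_n) c.
by have [Ac fc] := fsum (index_enum 'I_n) c; exists (\sum_k c k *: b k).
Qed.

Lemma tangent_basis n (M : manifold R n) c (x : M) :
  @charts R M c -> chart_dom c x ->
  is_basis (tangent x) (fun k => dvec c x (delta_mx ord0 k : 'rV[R]_n)).
Proof.
move=> cM xc; rewrite (tangentE (good_manifold M) cM xc).
apply: (@is_basis_map 'rV[R]_n _ setT (dvec c x)) => //.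
- by move=> a v w _ _; exact: dvecP.
- by move=> v _; exact: (dvec_inj (good_manifold M)).
- split => [k k0 i|].
    have := row_sum_delta (\row_i k i).
    under eq_bigr do rewrite mxE.
    by rewrite k0 => /rowP/(_ i); rewrite !mxE.
  rewrite eqEsubset; split => // v _; exists (fun k => v ord0 k).
  exact: row_sum_delta.
Qed.

Lemma smooth_dvec X (f : X -> R) c (x : X) (w : charted_model X) : good X ->
  charts c -> chart_dom c x -> smooth_fun_at f x ->
  smooth_fun_at (fun y => dvec c y w f) x.
Proof.
move=> gX cX xc sf.
apply: (@smooth_ext _ X (realline R)
  (fun y => 'D_w (fun z => f (chart_from c z)) (chart_to c y))) => //.
  by apply: filterS (smooth_nbhs gX findim_real sf) => y sy; rewrite /dvec asboolT.
apply: (@smooth_comp _ X (model_charted (charted_model X)) (realline R) (chart_to c)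
  (fun z => 'D_w (fun z => f (chart_from c z)) z)) => //.
- exact: good_model (good_findim gX).
- exact: smooth_chart_to.
- by apply/smooth_modelE/cinfty_derive; exact: smooth_fun_chart.
Qed.

(** In a product chart this is a directional derivative along [(0, 1)], restricted to the slice
    [t = 0]. It yields the smoothness of left-invariant fields and of fundamental fields. *)
Lemma smooth_partial X (W : normedModType R) (F : X -> R -> W) x :
  good X -> findim W ->
  @smooth2_at R X (realline R) (model_charted W) F x (0 : R) ->
  @smooth_at R X (model_charted W) (fun y => 'D_1 (F y) (0 : R)) x.
Proof.
move=> gX fW [_ sF]; have [c cX xc] := good_cover gX x.
have fX := good_findim gX; have gmX := good_model fX.
pose T := (charted_model X * R)%type.
pose G (p : T) := F (chart_from c p.1) p.2.
have cG : cinfty_near G ((chart_to c x, 0) : T).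
  apply: (sF (prod_chart c (Chart setT id id)) (Chart setT id id)) => //.
  by exists c, (Chart setT id id).
pose K (z : charted_model X) := 'D_(0, 1) G (z, 0).
apply: (@smooth_ext _ X (model_charted W) (fun y => K (chart_to c y))) => //.
  apply: filterS (chart_dom_near gX cX xc) => y yc.
  (* The two difference quotients coincide for every [h], so the derivatives agree as limits with no
     differentiability argument. *)
  have e : (fun h : R => h^-1 *: ((G \o shift ((chart_to c y, 0) : T)) (h *: (0, 1)) -
      G (chart_to c y, 0))) =
      (fun h : R => h^-1 *: ((F y \o shift 0) (h *: 1) - F y 0)).
    by apply/funext => h; rewrite /G /= scaler0 add0r (good_toK gX cX yc).
  by rewrite /K /derive e.
apply: (@smooth_comp _ X (model_charted (charted_model X)) (model_charted W)
  (chart_to c) K) => //.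
- exact: good_model.
- exact: smooth_chart_to.
apply/smooth_modelE.
apply: (@cinfty_comp _ _ T W (fun z => (z, 0)) (fun p => 'D_(0, 1) G p)) => //.
- exact: findim_prod fX findim_real.
- by apply: (@cinfty_pair _ _ _ _ id (fun=> 0)); [exact: cinfty_id|exact: cinfty_cst].
- exact: cinfty_derive.
Qed.

End TangentTheory.

(** * Ordinary differential equations *)

Section RealAnalysis.
Context {R : realType}.

Lemma exists_half_pow (C e : R) : 0 < e -> exists k : nat, C / 2 ^+ k < e.
Proof.
move=> e0; have [C0|C0] := leP C 0.
  by exists 0%N; rewrite expr0 divr1; exact: le_lt_trans e0.
pose k := (Num.truncn (C / e)).+1; exists k.
rewrite ltr_pdivrMr ?exprn_gt0 // -ltr_pdivrMl // mulrC.
apply: (@lt_trans _ _ k%:R).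
  by have /andP[_] := truncn_itv (divr_ge0 (ltW C0) (ltW e0)).
by rewrite -natrX ltr_nat ltn_expl.
Qed.

Lemma le_half_pow0 (a C : R) : (forall k : nat, a <= C / 2 ^+ k) -> a <= 0.
Proof.
move=> H; rewrite leNgt; apply/negP => a0.
have [k] := exists_half_pow C a0.
by move=> /(le_lt_trans (H k)); rewrite ltxx.
Qed.

Lemma geometric_limit n (u : nat -> 'rV[R]_n) (C : R) :
  (forall k, `|u k.+1 - u k| <= C / 2 ^+ k) ->
  exists l, forall k, `|l - u k| <= 2 * C / 2 ^+ k.
Proof.
move=> Hu.
have C0 : 0 <= C by have := Hu 0%N; rewrite expr0 divr1; exact: le_trans.
have Hd k m : `|u (k + m)%N - u k| <= 2 * C / 2 ^+ k.
  (* The factor [1 - 1 / 2 ^+ m] makes the bound the exact finite geometric sum, which is what the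
     induction on [m] can carry. *)
  suff : `|u (k + m)%N - u k| <= 2 * C / 2 ^+ k * (1 - 1 / 2 ^+ m).
    move=> /le_trans; apply; apply: ler_piMr.
      by rewrite !mulr_ge0 // invr_ge0 exprn_ge0.
    have : 0 <= 1 / 2 ^+ m :> R by rewrite divr_ge0 // exprn_ge0.
    by lra.
  elim: m => [|m IH].
    by rewrite addn0 subrr normr0 expr0 divr1 subrr mulr0.
  rewrite addnS -(subrKA (u (k + m)%N)).
  apply: le_trans (ler_normD _ _) _; apply: le_trans (lerD (Hu _) IH) _.
  rewrite exprD exprS le_eqVlt; apply/orP; left; apply/eqP.
  have p1 : 2 ^+ k != 0 :> R by rewrite expf_neq0.
  have p2 : 2 ^+ m != 0 :> R by rewrite expf_neq0.
  by field; rewrite p1 p2.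
have cu : cauchy (u @ \oo).
  apply: cauchy_exP => e e0; have [k ke] := exists_half_pow (2 * C) e0.
  exists (u k); exists k => // p /= kn; rewrite -ball_normE /= distrC.
  by rewrite -(subnKC kn); exact: le_lt_trans (Hd _ _) ke.
have /cauchy_cvgP/cvg_ex[l ul] := cu.
exists l => k; apply/ler_addgt0Pr => e e0.
have [N _ HN] := (cvgrPdist_lt _ _).1 ul e e0.
rewrite -(subrKA (u (k + N)%N)) addrC; apply: le_trans (ler_normD _ _) _.
by apply: lerD (Hd _ _) _; apply/ltW/HN; rewrite /= leq_addl.
Qed.

(** For [0 <= r] this is the 1-Lipschitz retraction of the line onto [[-r, r]]; it makes functions
    controlled only locally globally continuous or Lipschitz. *)
Definition clamp (r a : R) : R := Num.max (- r) (Num.min r a).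

Lemma clamp_lipschitz r a b : `|clamp r a - clamp r b| <= `|a - b|.
Proof.
have mono x y : x <= y -> 0 <= clamp r y - clamp r x <= y - x.
  move=> xy; rewrite /clamp /Order.max /Order.min.
  by case: (ltP r y) => ?; case: (ltP r x) => ?; case: (ltP (- r) r) => ?;
    case: (ltP (- r) x) => ?; case: (ltP (- r) y) => ?; lra.
have [/mono/andP[? ?]|/ltW/mono/andP[? ?]] := leP a b.
  by rewrite distrC (distrC a) !ger0_norm ?subr_ge0; lra.
by rewrite !ger0_norm ?subr_ge0; lra.
Qed.

Lemma clamp_id r a : `|a| <= r -> clamp r a = a.
Proof.
rewrite ler_norml /clamp => /andP[a1 a2].
by rewrite min_r // max_r.
Qed.

Lemma clamp_norm r a : 0 <= r -> `|clamp r a| <= r.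
Proof.
move=> r0; rewrite /clamp ler_norml le_max lexx /= ge_max ge_min lexx /= andbT.
by rewrite (le_trans _ r0) // oppr_le0.
Qed.

Lemma lipschitz_continuous (V W : normedModType R) (f : V -> W) (L : R) :
  (forall x y, `|f x - f y| <= L * `|x - y|) -> continuous f.
Proof.
move=> fL x; apply/cvgrPdist_lt => e e0.
have L0 : 0 < `|L| + 1 by rewrite ltr_wpDl.
near=> y; apply: le_lt_trans (fL x y) _.
apply: (@le_lt_trans _ _ ((`|L| + 1) * `|x - y|)).
  by rewrite ler_wpM2r // (le_trans (ler_norm L)) // lerDl.
rewrite -ltr_pdivlMl //.
near: y; apply/nbhs_normP; exists ((`|L| + 1)^-1 * e) => //=.
by rewrite mulr_gt0 // invr_gt0.
Unshelve. all: by end_near. Qed.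

Lemma clamp_continuous r : continuous (clamp r).
Proof.
by apply: (@lipschitz_continuous R R (clamp r) 1) => x y; rewrite mul1r clamp_lipschitz.
Qed.

Lemma is_derive1P (f : R -> R) (x d : R) :
  derivable f x (1 : R) -> derive1 f x = d -> is_derive x (1 : R) f d.
Proof. by rewrite derive1E => df <-; exact: DeriveDef. Qed.

Lemma real_antiderivative (f : R -> R) : continuous f ->
  exists2 A : R -> R, A 0 = 0 &
    forall t : R, `|t| < 1 -> is_derive t (1 : R) A (f t).
Proof.
move=> cf.
have fi : (@lebesgue_measure R).-integrable `[(-1 : R), 2] (EFin \o f).
  apply: continuous_compact_integrable; first exact: segment_compact.
  exact: continuous_subspaceT.
(* Integrating from -1 makes every [t] with [|t| < 1] lie strictly inside [[-1, 2]], negative times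
   included; [A 0] is subtracted afterwards. *)
pose A x := (\int[@lebesgue_measure R]_(t in [set` `[(-1)%R, x]]) f t)%R.
exists (fun t => A t - A 0); first exact: subrr.
move=> t t1.
have t2 : t < 2 by move: t1; rewrite ltr_norml => /andP[_]; lra.
have t3 : -1 < t by move: t1; rewrite ltr_norml => /andP[].
have [dA eA] := continuous_FTC1_closed t2 fi t3 (cf t).
have dA' : is_derive t (1 : R) A (f t) := is_derive1P dA eA.
rewrite -[f t]subr0; apply: is_deriveB.
Qed.

Section RowVectors.
Variable n : nat.
Local Notation V := 'rV[R]_n.

Lemma rV_norm_le (v : V) (C : R) : 0 <= C ->
  (forall k, `|v ord0 k| <= C) -> `|v| <= C.
Proof.
move=> C0 H; rewrite /Num.Def.normr /= mx_normrE; apply: bigmax_le => //.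
by move=> [i k] _ /=; rewrite ord1.
Qed.

Lemma rV_coord_le (v : V) k : `|v ord0 k| <= `|v|.
Proof.
rewrite [leRHS]/Num.Def.normr /= mx_normrE.
exact: (le_bigmax _ (fun ij : 'I_1 * 'I_n => `|v ij.1 ij.2|) (ord0, k)).
Qed.

Lemma is_derive_rV (x : R -> V) (t : R) (d : V) :
  is_derive t (1 : R) x d <->
  forall k, is_derive t (1 : R) (fun s => x s ord0 k) (d ord0 k).
Proof.
split=> [[dx <-] k|H].
  have /derivable_mxP dx' := dx.
  by apply: DeriveDef; [exact: dx'|rewrite derive_mx // mxE].
have dx : derivable x t 1.
  by apply/derivable_mxP => i k; rewrite ord1; have [] := H k.
apply: DeriveDef => //; rewrite derive_mx //; apply/rowP => k; rewrite mxE.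
by have [] := H k.
Qed.

Lemma antiderivative (f : R -> V) : continuous f ->
  exists2 A : R -> V, A 0 = 0 &
    forall t : R, `|t| < 1 -> is_derive t (1 : R) A (f t).
Proof.
move=> cf; have ck k : continuous (fun t => f t ord0 k).
  move=> t; apply: (@continuous_comp _ _ _ f (fun v : V => v ord0 k)).
    exact: cf.
  exact: coord_continuous.
have /choice[A HA] : forall k, exists A : R -> R, A 0 = 0 /\
    forall t : R, `|t| < 1 -> is_derive t (1 : R) A (f t ord0 k).
  by move=> k; have [A A0 dA] := real_antiderivative (ck k); exists A.
exists (fun t => \row_k A k t).
  by apply/rowP => k; rewrite !mxE; case: (HA k).
move=> t t1; apply/is_derive_rV => k.
under eq_fun do rewrite mxE.
by have [_] := HA k; exact.
Qed.

(** The norm is the maximum of the coordinates, so the scalar mean value theorem applies to each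
    coordinate, with its own intermediate point. *)
Lemma rV_mean_value (x : R -> V) (d : R -> V) (a b C : R) : a <= b ->
  (forall t : R, a <= t <= b -> is_derive t (1 : R) x (d t) /\ `|d t| <= C) ->
  `|x b - x a| <= C * (b - a).
Proof.
move=> ab H; have C0 : 0 <= C.
  by apply: le_trans (H a _).2; rewrite ?normr_ge0 // lexx ab.
apply: rV_norm_le => [|k]; first by rewrite mulr_ge0 // subr_ge0.
have dk (t : R) : a <= t <= b -> is_derive t (1 : R) (fun s => x s ord0 k) (d t ord0 k).
  by move=> /H[/is_derive_rV].
have [||c cab e] := @MVT_segment R (fun s => x s ord0 k) (fun s => d s ord0 k) a b ab.
- by move=> t; rewrite in_itv /= => /andP[? ?]; apply: dk; rewrite !ltW.
- apply: derivable_within_continuous => t; rewrite in_itv /= => /dk[].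
  by [].
rewrite !mxE e normrM [`|b - a|]ger0_norm ?subr_ge0 //.
apply: ler_wpM2r; first by rewrite subr_ge0.
by apply: le_trans (rV_coord_le _ _) _; apply: (H c _).2; move: cab; rewrite in_itv.
Qed.

Lemma rV_mean_value0 (x : R -> V) (d : R -> V) (e C : R) :
  (forall t : R, `|t| < e -> is_derive t (1 : R) x (d t) /\ `|d t| <= C) ->
  forall t, `|t| < e -> `|x t - x 0| <= C * `|t|.
Proof.
move=> H t te; have [t0|t0] := leP 0 t.
  rewrite ger0_norm // -[t in leRHS]subr0; apply: (rV_mean_value (d := d)) => // s.
  move=> /andP[s0 st]; apply: H; rewrite ger0_norm //.
  by apply: le_lt_trans st _; move: te; rewrite ger0_norm.
rewrite distrC (ltr0_norm t0) -[- t]add0r; apply: (rV_mean_value (d := d)) => [|s].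
  exact: ltW.
move=> /andP[ts s0]; apply: H; rewrite ler0_norm //.
by apply: le_lt_trans te; rewrite ltr0_norm // lerN2.
Qed.

End RowVectors.
End RealAnalysis.

(** * Picard iteration for a bounded, globally Lipschitz field *)

Section Picard.
Context {R : realType} {n : nat}.
Local Notation V := 'rV[R]_n.
Variables (F : V -> V) (K L : R).
Hypotheses (L0 : 0 <= L) (FK : forall z, `|F z| <= K).
Hypothesis FL : forall y z, `|F y - F z| <= L * `|y - z|.

Let K0 : 0 <= K. Proof. exact: le_trans (FK 0). Qed.

Lemma is_derive_sub (x y : R -> V) (t : R) (d d' : V) :
  is_derive t (1 : R) x d -> is_derive t (1 : R) y d' ->
  is_derive t (1 : R) (fun t => x t - y t) (d - d').
Proof. by move=> dx dy; exact: is_deriveB. Qed.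

(** The contraction: the derivatives differ by at most [L * C], over a time at most [e] with
    [L * e <= 1 / 2]. Keeping the driving curves [dx], [dy] apart from [x], [y] covers solutions and
    successive iterates alike. *)
Let compare (x y : R -> V) (dx dy : R -> V) (e C : R) :
  0 <= C -> L * e <= 1 / 2 ->
  (forall t : R, `|t| < e -> is_derive t (1 : R) x (F (dx t))) ->
  (forall t : R, `|t| < e -> is_derive t (1 : R) y (F (dy t))) -> x 0 = y 0 ->
  (forall t, `|t| < e -> `|dx t - dy t| <= C) ->
  forall t, `|t| < e -> `|x t - y t| <= C / 2.
Proof.
move=> C0 Le Hx Hy xy0 HC t te.
have -> : x t - y t = (x t - y t) - (x 0 - y 0) by rewrite xy0 subrr subr0.
apply: le_trans (@rV_mean_value0 R n (fun t => x t - y t)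
  (fun t => F (dx t) - F (dy t)) e (L * C) _ t te) _.
  move=> s se; split; first exact: is_derive_sub (Hx _ se) (Hy _ se).
  by apply: le_trans (FL _ _) _; rewrite ler_wpM2l // HC.
apply: (@le_trans _ _ (L * C * e)); first by rewrite ler_wpM2l ?mulr_ge0 // ltW.
by nra.
Qed.

Lemma ode_unique (x y : R -> V) (e : R) : L * e <= 1 / 2 ->
  (forall t : R, `|t| < e -> is_derive t (1 : R) x (F (x t))) ->
  (forall t : R, `|t| < e -> is_derive t (1 : R) y (F (y t))) -> x 0 = y 0 ->
  forall t, `|t| < e -> x t = y t.
Proof.
move=> Le Hx Hy xy0 t te; apply/eqP; rewrite -subr_eq0 -normr_le0.
have e0 : 0 <= e by apply: ltW (le_lt_trans _ te).
(* The bound [2 * K * e] comes from [|F| <= K] alone; each use of [compare] then halves it, so the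
   difference is zero. *)
apply: (@le_half_pow0 _ _ (2 * K * e)) => k.
elim: k t te => [|k IH] t te.
  rewrite expr0 divr1.
  have -> : x t - y t = (x t - y t) - (x 0 - y 0) by rewrite xy0 subrr subr0.
  apply: le_trans (@rV_mean_value0 R n (fun t => x t - y t)
    (fun t => F (x t) - F (y t)) e (2 * K) _ t te) _.
    move=> s se; split; first exact: is_derive_sub (Hx _ se) (Hy _ se).
    apply: le_trans (ler_normB _ _) _.
    by have := FK (x s); have := FK (y s); lra.
  by rewrite ler_wpM2l ?mulr_ge0 // ltW.
rewrite exprSr invfM mulrA; apply: (compare (dx := x) (dy := y) (e := e)) => //.
by rewrite !mulr_ge0 // invr_ge0 exprn_ge0.
Qed.

Lemma ode_exists (x0 : V) (e : R) : 0 < e -> e <= 1 / 2 -> L * e <= 1 / 2 ->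
  exists2 x : R -> V, x 0 = x0 &
    forall t : R, `|t| < e / 2 -> is_derive t (1 : R) x (F (x t)).
Proof.
move=> e0 e12 Le.
have cF : continuous F by exact: lipschitz_continuous FL.
(* Choosing an antiderivative for every [f] at once makes the iteration a plain recursion; the value
   at a discontinuous [f] is a dummy. *)
have /choice[I HI] : forall f : R -> V, exists A : R -> V, continuous f -> A 0 = 0 /\
    forall t : R, `|t| < 1 -> is_derive t (1 : R) A (f t).
  move=> f; have [cf|ncf] := pselect (continuous f); last by exists (fun=> 0).
  by have [A A0 dA] := antiderivative cf; exists A.
(* Antiderivatives are controlled only for [|t| < 1], while the next step needs an integrand
   continuous on the whole line; [clamp e] freezes the iterate beyond time [e]. *)
pose y := fix y k : R -> V :=
  if k is k'.+1 then fun t => x0 + I (F \o y k') (clamp e t) else fun=> x0.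
have le_e := ltW e0; have e1 : e < 1 by lra.
have cy k : continuous (y k).
  elim: k => [|k IH]; first by move=> t; exact: cst_continuous.
  have cFy : continuous (F \o y k).
    by move=> t; apply: continuous_comp; [exact: IH|exact: cF].
  have [_ dI] := HI _ cFy; move=> t.
  apply: (@continuousD _ _ _ (fun=> x0)); first exact: cst_continuous.
  apply: (@continuous_comp _ _ _ (clamp e)); first exact: clamp_continuous.
  have /dI[+ _] : `|clamp e t| < 1 by apply: le_lt_trans (clamp_norm _ le_e) e1.
  by move=> /derivable1_diffP/differentiable_continuous.
have cFy k : continuous (F \o y k).
  by move=> t; apply: continuous_comp; [exact: cy|exact: cF].
have y0 k : y k 0 = x0.
  case: k => //= k; have [I0 _] := HI _ (cFy k).
  by rewrite clamp_id ?normr0 // I0 addr0.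
have addx0 (A : R -> V) (t : R) (d : V) : is_derive t (1 : R) A d ->
    is_derive t (1 : R) (fun s => x0 + A s) d.
  move=> dA; rewrite -[d]add0r.
  exact: (@is_deriveD _ _ _ (fun=> x0) A t 1 0 d).
have dy k (t : R) : `|t| < e -> is_derive t (1 : R) (y k.+1) (F (y k t)).
  move=> te; have [_ dI] := HI _ (cFy k).
  apply: (@near_eq_is_derive _ _ _ (fun s => x0 + I (F \o y k) s)).
    have : \forall s \near t, `|s| < e.
      by apply: (@norm_continuous R R t [set z | z < e]); exact: lt_nbhsl.
    by apply: filterS => s se /=; rewrite clamp_id // ltW.
  by apply/addx0/dI/(lt_trans te).
have Hy k (t : R) : `|t| < e -> `|y k.+1 t - y k t| <= K / 2 ^+ k.
  elim: k t => [|k IH] t te.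
    rewrite expr0 divr1 -[y 0%N t]/x0 -(y0 1%N).
    apply: le_trans (@rV_mean_value0 R n (y 1%N) (fun t => F (y 0%N t)) e K _ t te) _.
      by move=> s se; split; [exact: dy|exact: FK].
    by apply: ler_piMr => //; lra.
  rewrite exprSr invfM mulrA.
  apply: (compare (dx := y k.+1) (dy := y k) (e := e)) => //.
  - by rewrite mulr_ge0 // invr_ge0 exprn_ge0.
  - by rewrite !y0.
have /choice[X HX] : forall t : R, exists l : V, `|t| < e ->
    forall k, `|l - y k t| <= 2 * K / 2 ^+ k.
  move=> t; have [te|nte] := ltP `|t| e; last by exists 0.
  have [l Hl] := @geometric_limit _ _ (fun k => y k t) K (fun k => Hy k t te).
  by exists l.
(* The iterates are [K]-Lipschitz, and this bound survives a pointwise limit; it gives the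
   continuity of [X] without uniform convergence. *)
have XL (s t : R) : `|s| < e -> `|t| < e -> `|X s - X t| <= K * `|s - t|.
  move=> se te; rewrite -subr_le0; apply: (@le_half_pow0 _ _ (2 * K)) => k.
  have yL : `|y k.+1 s - y k.+1 t| <= K * `|s - t|.
    wlog st : s t se te / t <= s.
      move=> H; have [|/ltW] := leP t s; first exact: H.
      by rewrite distrC (distrC s); exact: H.
    rewrite (ger0_norm (_ : 0 <= s - t)) ?subr_ge0 //.
    apply: (rV_mean_value (d := fun t => F (y k t))) => // r /andP[tr rs].
    split; last exact: FK.
    by apply: dy; move: se te; rewrite !ltr_norml => /andP[? ?] /andP[? ?]; lra.
  have -> : X s - X t = (X s - y k.+1 s) + (y k.+1 s - y k.+1 t) - (X t - y k.+1 t).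
    by apply/rowP => i; rewrite !mxE; ring.
  rewrite lerBlDr; apply: le_trans (ler_normB _ _) _.
  apply: le_trans (lerD (ler_normD _ _) (HX _ te k.+1)) _.
  have h1 := HX _ se k.+1.
  have h2 : 2 * K / 2 ^+ k.+1 = K / 2 ^+ k.
    by rewrite exprS; field; rewrite expf_neq0.
  by rewrite h2 in h1 *; lra.
(* Clamping at [e / 2] keeps the argument strictly inside [|t| < e], where [X] is controlled;
   clamping at [e] would reach the end point. *)
pose X' t := X (clamp (e / 2) t).
have e2 : 0 <= e / 2 by lra.
have ce t : `|clamp (e / 2) t| < e by apply: le_lt_trans (clamp_norm _ e2) _; lra.
have cX' : continuous X'.
  apply: (@lipschitz_continuous _ R V _ K) => s t.
  apply: le_trans (XL _ _ (ce _) (ce _)) _.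
  by rewrite ler_wpM2l // clamp_lipschitz.
have cFX : continuous (F \o X').
  by move=> t; apply: continuous_comp; [exact: cX'|exact: cF].
have [z z0 dz] : exists2 z : R -> V, z 0 = x0 &
    forall t : R, `|t| < e / 2 -> is_derive t (1 : R) z (F (X t)).
  have [I0 dI] := HI _ cFX; exists (fun t => x0 + I (F \o X') t).
    by rewrite I0 addr0.
  move=> t te; apply: addx0; have /dI/= : `|t| < 1 by lra.
  by rewrite /X' clamp_id // ltW.
(* [z] is driven by [X] and [y k.+1] by [y k], which are [2 * K / 2 ^+ k] apart, so [compare] makes
   [z] a limit of the iterates too. *)
have zX t : `|t| < e / 2 -> z t = X t.
  move=> te; apply/eqP; rewrite -subr_eq0 -normr_le0.
  apply: (@le_half_pow0 _ _ (2 * K)) => k.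
  have zy : `|z t - y k.+1 t| <= 2 * K / 2 ^+ k / 2.
    have C0 : 0 <= 2 * K / 2 ^+ k by rewrite !mulr_ge0 // invr_ge0 exprn_ge0.
    have Le2 : L * (e / 2) <= 1 / 2 by nra.
    have zy0 : z 0 = y k.+1 0 by rewrite z0 y0.
    refine (compare C0 Le2 dz _ zy0 _ te) => s se; first by apply: dy; lra.
    by apply: HX; lra.
  rewrite -(subrKA (y k.+1 t)); apply: le_trans (ler_normD _ _) _.
  have te' : `|t| < e by lra.
  have := HX _ te' k.+1; rewrite distrC.
  have -> : 2 * K / 2 ^+ k.+1 = 2 * K / 2 ^+ k / 2.
    by rewrite exprS; field; rewrite expf_neq0.
  by lra.
exists z => //.
by move=> t te; rewrite zX //; exact: dz.
Qed.

End Picard.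

(** * Local solutions of smooth vector fields *)

Section LocalFlow.
Context {R : realType} {n : nat}.
Local Notation V := 'rV[R]_n.

Lemma cinfty_locally_lipschitz (F : V -> V) (x0 : V) : cinfty_near F x0 ->
  exists r K L : R, [/\ 0 < r, 0 <= L,
    forall z, `|z - x0| <= r -> cinfty_near F z,
    forall z, `|z - x0| <= r -> `|F z| <= K &
    forall y z, `|y - x0| <= r -> `|z - x0| <= r ->
      `|F y - F z| <= L * `|y - z|].
Proof.
move=> cF.
pose e k : V := delta_mx ord0 k.
have bnd (f : V -> V) : cinfty_near f x0 ->
    \forall z \near x0, `|f z| <= `|f x0| + 1.
  move=> /cinfty_continuous cf.
  have cf1 : \forall z \near x0, `|f x0 - f z| < 1.
    by exact: (cvgrPdist_lt _ _).1 cf 1 ltr01.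
  apply: filterS cf1 => z /ltW fz.
  by have := ler_distD (f x0) (f z) 0; rewrite !subr0 distrC; lra.
have H : \forall z \near x0, [/\ cinfty_near F z, `|F z| <= `|F x0| + 1 &
    forall k, `|'D_(e k) F z| <= `|'D_(e k) F x0| + 1].
  have n1 := cinfty_nbhs cF; have n2 := bnd _ cF.
  have n3 : \forall z \near x0, forall k, `|'D_(e k) F z| <= `|'D_(e k) F x0| + 1.
    have bk k : \forall z \near x0, `|'D_(e k) F z| <= `|'D_(e k) F x0| + 1.
      by apply: (bnd (fun z => 'D_(e k) F z)); exact: cinfty_derive.
    exact: filter_forall bk.
  by near=> z; split; near: z.
have /nbhs_normP[r /= r0 Hr] := H.
(* Near [x0] each partial derivative is at most its value at [x0] plus 1 in norm, and the
   coordinates of [y - z] are at most [|y - z|]; so [L] bounds the derivative along the segment from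
   [z] to [y]. *)
pose L := \sum_k (`|'D_(e k) F x0| + 1).
have L0 : 0 <= L by apply: sumr_ge0 => k _; rewrite addr_ge0.
have Hr2 z : `|z - x0| <= r / 2 -> ball_ Num.Def.normr x0 r z.
  by move=> zr /=; rewrite distrC; lra.
exists (r / 2), (`|F x0| + 1), L; split => //.
- by lra.
- by move=> z /Hr2/Hr[].
- by move=> z /Hr2/Hr[].
move=> y z yr zr.
pose g (t : R) := F (z + t *: (y - z)).
have -> : F y - F z = g 1 - g 0.
  by rewrite /g scale1r scale0r addr0 (addrCA z) subrr addr0.
rewrite -[leRHS]mulr1 -[X in _ * X](subr0 1).
refine (@rV_mean_value R n g (fun t => 'D_(y - z) F (z + t *: (y - z))) 0 1 _ ler01 _).
move=> t /andP[t0 t1].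
have [|cFz _ bF] := Hr (z + t *: (y - z)).
  apply: Hr2; have -> : z + t *: (y - z) - x0 = (1 - t) *: (z - x0) + t *: (y - x0).
    by apply/rowP => k; rewrite !mxE; ring.
  apply: le_trans (ler_normD _ _) _; rewrite !normrZ !ger0_norm //; last by lra.
  by nra.
have dF := cinfty_differentiable cFz.
have dl : differentiable (fun t : R => z + t *: (y - z)) t.
  exact: cinfty_differentiable (cinfty_line _ _ _).
have Dl : 'D_1 (fun t : R => z + t *: (y - z)) t = y - z.
  exact: derive_line.
split.
  apply: DeriveDef; first by apply/diff_derivable/(differentiable_comp dl dF).
  by rewrite (@derive_comp R R V V (fun t : R => z + t *: (y - z)) F t 1 dl dF) Dl.
have yzE := row_sum_delta (y - z).
rewrite deriveE // [X in 'd F _ X]yzE linear_sum /L mulr_suml.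
apply: le_trans (ler_norm_sum _ _ _) _; apply: ler_sum => k _.
rewrite linearZ normrZ mulrC; apply: ler_pM => //.
  by rewrite -deriveE //; exact: bF.
exact: rV_coord_le.
Unshelve. all: by end_near. Qed.

End LocalFlow.

Section LocalSolutions.
Context {R : realType} {n : nat}.
Local Notation V := 'rV[R]_n.

Lemma cinfty_ck (V' W : normedModType R) (U : set V') (f : V' -> W) k :
  (forall x, U x -> cinfty_near f x) -> ck k U f.
Proof.
elim: k f => [|k IH] f cf /=; first by move=> x /cf/cinfty_continuous.
split=> [x /cf/cinfty_differentiable //|v].
by apply: IH => x /cf; exact: cinfty_derive.
Qed.

(* Composing a vector field with this retraction onto a box around x0 makes it
   globally bounded and Lipschitz, so that Picard iterates never leave its
   domain. *)
Definition clampv (x0 : V) (r : R) (z : V) : V :=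
  x0 + \row_k clamp r (z ord0 k - x0 ord0 k).

Lemma clampv_lipschitz x0 r y z : `|clampv x0 r y - clampv x0 r z| <= `|y - z|.
Proof.
apply: rV_norm_le => // k; rewrite !mxE opprD addrACA subrr add0r.
apply: le_trans (clamp_lipschitz _ _ _) _.
have := rV_coord_le (y - z) k; rewrite !mxE; congr (`|_| <= _); ring.
Qed.

Lemma clampv_id x0 r z : `|z - x0| <= r -> clampv x0 r z = z.
Proof.
move=> zr; apply/rowP => k; rewrite !mxE clamp_id; first by rewrite addrC subrK.
have := rV_coord_le (z - x0) k; rewrite !mxE => zk; exact: le_trans zk zr.
Qed.

Lemma clampv_norm x0 r z : 0 <= r -> `|clampv x0 r z - x0| <= r.
Proof.
move=> r0; rewrite /clampv addrC addKr; apply: rV_norm_le => // k.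
by rewrite !mxE clamp_norm.
Qed.

(** Bootstrapping: the derivative of [x] is [G] composed with [x], so a [C^k] solution is
    [C^(k+1)]. *)
Lemma solution_smooth (F x : R -> V) (G : V -> V) (e : R) (t : R) :
  (forall s : R, `|s| < e -> cinfty_near G (x s)) ->
  (forall s : R, `|s| < e -> is_derive s (1 : R) x (G (x s))) ->
  `|t| < e -> cinfty_near x t.
Proof.
move=> cG dx te; pose U := [set s : R | `|s| < e].
have oU : open U.
  rewrite openE => s se; apply: (@norm_continuous R R s [set z | z < e]).
  exact: lt_nbhsl.
pose B := [set z | cinfty_near G z].
have oB : open B by rewrite openE => z; exact: cinfty_nbhs.
have df s : U s -> differentiable x s.
  by move=> /dx[+ _]; rewrite derivable1_diffP.
exists U; split=> // k; elim: k => [|k IH].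
  by move=> s /df; exact: differentiable_continuous.
split => // v.
apply: (@ck_ext _ _ _ k U (fun s => v *: G (x s))) => //.
  move=> s Us; rewrite deriveE; last exact: df.
  have [_ <-] := dx _ Us; rewrite deriveE; last exact: df.
  by rewrite -linearZ; congr ('d x s _); rewrite /GRing.scale /= mulr1.
apply: (@ckZ _ R V k U (fun=> v)) => //; first exact: findim_rV.
  exact: ck_cst.
apply: (@ck_comp _ R V V k U B) => //; first exact: findim_rV.
- exact: findim_rV.
- exact: cinfty_ck.
Qed.

Lemma local_solution (F : V -> V) (x0 : V) : cinfty_near F x0 ->
  exists (r e : R) (x : R -> V), [/\ 0 < r, 0 < e, x 0 = x0,
    forall t, `|t| < e -> [/\ cinfty_near x t, is_derive t (1 : R) x (F (x t)) &
                              `|x t - x0| <= r] &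
    forall (d : R) (y z : R -> V), d <= e ->
      (forall t, `|t| < d -> is_derive t (1 : R) y (F (y t)) /\ `|y t - x0| <= r) ->
      (forall t, `|t| < d -> is_derive t (1 : R) z (F (z t)) /\ `|z t - x0| <= r) ->
      y 0 = z 0 -> forall t, `|t| < d -> y t = z t].
Proof.
move=> /cinfty_locally_lipschitz[r [K [L [r0 L0 cF FK FL]]]].
have r0' := ltW r0.
pose G z := F (clampv x0 r z).
have GK z : `|G z| <= K by apply/FK/clampv_norm.
have GL y z : `|G y - G z| <= L * `|y - z|.
  apply: le_trans (FL _ _ (clampv_norm _ _ r0') (clampv_norm _ _ r0')) _.
  by rewrite ler_wpM2l // clampv_lipschitz.
have GE z : `|z - x0| <= r -> G z = F z by move=> zr; rewrite /G clampv_id.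
have K0 : 0 <= K by exact: le_trans (GK 0).
(* The term [+ 1] yields [e <= 1 / 2] along with [L * e <= 1 / 2], also when [L = 0]. *)
pose e := (2 * (L + 1))^-1.
have e0 : 0 < e by rewrite invr_gt0; nra.
have eE : e * (2 * (L + 1)) = 1 by rewrite mulVf // gt_eqF //; nra.
have e12 : e <= 1 / 2 by nra.
have Le : L * e <= 1 / 2 by nra.
have [x x00 dx] := ode_exists L0 GK GL x0 e0 e12 Le.
(* At speed at most [K] the solution stays within [r] of [x0] up to time [r / (K + 1)], and there
   the clamped field [G] agrees with [F]. *)
pose d := Num.min (e / 2) (r / (K + 1)).
have K1 : 0 < K + 1 by lra.
have d0 : 0 < d by rewrite lt_min !divr_gt0.
have de : d <= e / 2 by rewrite ge_min lexx.
have dr : (K + 1) * d <= r by rewrite mulrC -ler_pdivlMr // ge_min lexx orbT.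
have xr t : `|t| < d -> `|x t - x0| <= r.
  move=> td; rewrite -x00.
  apply: le_trans (@rV_mean_value0 R n x (fun t => G (x t)) d K _ t td) _.
    by move=> s sd; split; [apply: dx; lra|exact: GK].
  by have := normr_ge0 t; nra.
have dx' t : `|t| < d -> is_derive t (1 : R) x (F (x t)).
  by move=> td; rewrite -GE ?xr //; apply: dx; lra.
exists r, d, x; split => //.
- move=> t td; split; [|exact: dx'|exact: xr].
  by apply: (@solution_smooth x x F d) => // s sd; exact/cF/xr.
- move=> c y z cd Hy Hz yz0 t tc.
  apply: (ode_unique L0 GK GL (e := c)) tc => //.
  + by nra.
  + by move=> s /Hy[dy /GE ->].
  + by move=> s /Hz[dz /GE ->].
Qed.

End LocalSolutions.

(** * One-parameter subgroups *)

Section LieGroupTheory.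
Context {R : realType} {n : nat}.
Variable H : lie_group R n.
Local Notation mul := (@lie_mul R n H).
Local Notation inv := (@lie_inv R n H).
Local Notation one := (lie_one H).

Lemma lie_mulKl (a b : H) : mul (inv a) (mul a b) = b.
Proof. by rewrite lie_mulA lie_mulV lie_mul1. Qed.

Lemma lie_mulI (a b c : H) : mul a b = mul a c -> b = c.
Proof. by move=> abc; rewrite -(lie_mulKl a b) abc lie_mulKl. Qed.

Lemma lie_mulr1 (a : H) : mul a one = a.
Proof. by apply: (@lie_mulI (inv a)); rewrite lie_mulA lie_mulV lie_mul1. Qed.

Lemma lie_mulrV (a : H) : mul a (inv a) = one.
Proof. by apply: (@lie_mulI (inv a)); rewrite lie_mulA lie_mulV lie_mul1 lie_mulr1. Qed.

Let gH : good H := good_manifold H.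

Lemma lie_mulr_smooth (a b : H) : smooth_at (mul a) b.
Proof.
apply: (@smooth2_comp R H H H H mul (fun=> a) id) => //; first exact: lie_mul_smooth.
  exact: smooth_cst.
exact: smooth_id.
Qed.

Definition lie_pow (a : H) (k : nat) : H := iter k (mul a) one.

Lemma lie_powM a k l : lie_pow a (k * l) = lie_pow (lie_pow a k) l.
Proof.
have powD i j : lie_pow a (i + j) = mul (lie_pow a i) (lie_pow a j).
  by elim: i => [|i IH] /=; rewrite ?lie_mul1 // IH lie_mulA.
by elim: l => [|l IH]; rewrite ?muln0 // mulnS powD IH.
Qed.

Lemma lie_powMn a b k : mul a b = mul b a ->
  lie_pow (mul a b) k = mul (lie_pow a k) (lie_pow b k).
Proof.
move=> ab; have comm i : mul b (lie_pow a i) = mul (lie_pow a i) b.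
  elim: i => [|i IH] /=; first by rewrite lie_mul1 lie_mulr1.
  by rewrite lie_mulA -ab -!lie_mulA IH.
elim: k => [|k IH] /=; first by rewrite lie_mul1.
by rewrite IH -!lie_mulA; congr (mul a _); rewrite !lie_mulA comm.
Qed.

Section Extension.
Variables (a : R -> H) (e : R).
Hypotheses (e0 : 0 < e).
Hypothesis aD : forall s t, `|s| < e -> `|t| < e -> `|s + t| < e ->
  a (s + t) = mul (a s) (a t).

Let a0 : a 0 = one.
Proof.
have H0 : `|0 : R| < e by rewrite normr0.
have := aD H0 H0; rewrite addr0 => /(_ H0) a00.
by apply: (@lie_mulI (a 0)); rewrite lie_mulr1.
Qed.

Let aM (k : nat) u : `|u| < e -> `|k%:R * u| < e -> a (k%:R * u) = lie_pow (a u) k.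
Proof.
move=> ue; elim: k => [|k IH] ke; first by rewrite mul0r a0.
have ke' : `|k%:R * u| < e.
  apply: le_lt_trans ke; rewrite !normrM ler_wpM2r // !normr_nat ler_nat.
  exact: leqnSn.
by rewrite -natr1 mulrDl mul1r addrC /= aD ?IH // addrC -{2}[u]mul1r -mulrDl natr1.
Qed.

(** Two subdivisions of [t] are compared through their common refinement into [k.+1 * l.+1]
    pieces. *)
Let ext_eq (k l : nat) t : `|t| < k.+1%:R * e -> `|t| < l.+1%:R * e ->
  lie_pow (a (t / k.+1%:R)) k.+1 = lie_pow (a (t / l.+1%:R)) l.+1.
Proof.
move=> tk tl.
suff key i j : `|t| < i.+1%:R * e ->
    lie_pow (a (t / i.+1%:R)) i.+1 = lie_pow (a (t / (i.+1 * j.+1)%:R)) (i.+1 * j.+1).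
  by rewrite (key k l) // (key l k) // mulnC.
move=> ti; rewrite mulnC lie_powM; congr (lie_pow _ _).
have i0 : 0 < i.+1%:R :> R by [].
have j0 : 0 < j.+1%:R :> R by [].
have te : `|t / i.+1%:R| < e.
  by rewrite normrM normfV normr_nat ltr_pdivrMr // mulrC.
have tE : t / i.+1%:R = j.+1%:R * (t / (j.+1 * i.+1)%:R).
  by rewrite natrM invfM (mulrCA t) mulVKf // gt_eqF.
rewrite tE aM -?tE //.
apply: le_lt_trans te; rewrite !normrM ler_wpM2l // !normfV !normr_nat.
by rewrite lef_pV2 ?posrE ?ltr0n ?muln_gt0 // ler_nat leq_pmull.
Qed.

(* c t = a (t / k) ^ k for every k large enough. *)
Lemma extend_one_parameter : exists c : R -> H,
  (forall s t, c (s + t) = mul (c s) (c t)) /\ forall t, `|t| < e -> c t = a t.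
Proof.
pose N (t : R) := Num.truncn (`|t| / e).
have NE t : `|t| < (N t).+1%:R * e.
  rewrite -ltr_pdivrMr //.
  by have /andP[_] := truncn_itv (divr_ge0 (normr_ge0 t) (ltW e0)).
have mono (k l : nat) t : `|t| < k.+1%:R * e -> (k <= l)%N -> `|t| < l.+1%:R * e.
  by move=> /lt_le_trans tk kl; apply: tk; rewrite ler_pM2r // ler_nat.
pose c t := lie_pow (a (t / (N t).+1%:R)) (N t).+1.
have cE k t : `|t| < k.+1%:R * e -> c t = lie_pow (a (t / k.+1%:R)) k.+1.
  by move=> tk; exact: ext_eq.
exists c; split => [s t|t te]; last first.
  by rewrite (cE 0%N) ?mul1r // divr1 /= lie_mulr1.
(* One subdivision fine enough for [s], [t] and [s + t]. *)
pose k := (N s + N t + N (s + t)%R)%N.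
have sk : `|s| < k.+1%:R * e by apply: mono (NE s) _; rewrite /k -addnA leq_addr.
have tk : `|t| < k.+1%:R * e.
  by apply: mono (NE t) _; rewrite /k addnAC leq_addl.
have stk : `|s + t| < k.+1%:R * e by apply: mono (NE _) _; rewrite /k leq_addl.
have k0 : 0 < k.+1%:R :> R by [].
have small u : `|u| < k.+1%:R * e -> `|u / k.+1%:R| < e.
  by move=> uk; rewrite normrM normfV normr_nat ltr_pdivrMr // mulrC.
rewrite !(cE k) //.
have <- : mul (a (s / k.+1%:R)) (a (t / k.+1%:R)) = a ((s + t) / k.+1%:R).
  by rewrite mulrDl aD ?small // -mulrDl small.
(* The two factors commute because both products are the value of [a] at [(s + t) / k.+1]. *)
apply: lie_powMn; rewrite -!aD ?small // -?mulrDl ?small //; last by rewrite addrC.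
by rewrite addrC.
Qed.

End Extension.
End LieGroupTheory.

(** * Integral curves of left-invariant vector fields *)

Section OneParameterSubgroups.
Context {R : realType} {n : nat}.
Variable H : lie_group R n.
Local Notation V := 'rV[R]_n.
Local Notation mul := (@lie_mul R n H).
Local Notation one := (lie_one H).

Let gH : good H := good_manifold H.
Let gR : good (realline R) := good_real.
Let gV : good (euclid R n) := good_euclid n.

Variables (k : chart H V) (u : R -> H).
Hypotheses (kH : @charts R H k) (k1 : chart_dom k one).
Hypotheses (su : smooth_curve u) (u0 : u 0 = one).

(* The left-invariant vector field with value velocity u at the unit, read in the
   chart k. *)
Let F (z : V) : V := 'D_1 (fun t : R => chart_to k (mul (chart_from k z) (u t))) (0 : R).

Let smooth_to a : chart_dom k a -> @smooth_at R H (euclid R n) (chart_to k) a.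
Proof. exact: smooth_chart_to. Qed.

Let smooth_from a : chart_dom k a ->
  @smooth_at R (euclid R n) H (chart_from k) (chart_to k a).
Proof. exact: smooth_chart_from. Qed.

Let smoothF : cinfty_near F (chart_to k one).
Proof.
have k1' : chart_from k (chart_to k one) = one by exact: (good_toK gH).
apply/smooth_modelE.
apply: (@smooth_partial R (euclid R n) V
  (fun z t => chart_to k (mul (chart_from k z) (u t))) (chart_to k one)) => //.
  exact: findim_rV.
have s1 : @smooth2_at R (euclid R n) (realline R) H
    (fun z t => mul (chart_from k z) (u t)) (chart_to k one) (0 : R).
  apply: (smooth2_at_comp gV gR gH gH gH).
  - exact: lie_mul_smooth.
  - exact: smooth_from.
  - exact: su.
apply: (smooth2_at_post gV gR gH gV s1).
by rewrite k1' u0 lie_mul1; exact: smooth_to.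
Qed.

Let translate (g : H) (z : V) : V := chart_to k (mul g (chart_from k z)).

Let smooth_translate g b : chart_dom k b -> chart_dom k (mul g b) ->
  cinfty_near (translate g) (chart_to k b).
Proof.
move=> kb kgb; have kb' : chart_from k (chart_to k b) = b by exact: (good_toK gH).
apply/smooth_modelE.
apply: (@smooth_comp R (euclid R n) H (euclid R n)
  (fun z => mul g (chart_from k z)) (chart_to k)) => //; last first.
  by rewrite kb'; exact: smooth_to.
apply: (@smooth_comp R (euclid R n) H H (chart_from k) (mul g)) => //.
  exact: smooth_from.
exact: lie_mulr_smooth.
Qed.

(** [F] at [b] is the velocity of [t |-> b * u t], which left translation by [g] carries to
    [t |-> (g * b) * u t] by associativity. *)
Let invariant g b : chart_dom k b -> chart_dom k (mul g b) ->
  'D_(F (chart_to k b)) (translate g) (chart_to k b) = F (chart_to k (mul g b)).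
Proof.
move=> kb kgb; have kb' : chart_from k (chart_to k b) = b by exact: (good_toK gH).
have kgb' : chart_from k (chart_to k (mul g b)) = mul g b by exact: (good_toK gH).
pose w t := mul b (u t).
have w0 : w 0 = b by rewrite /w u0 lie_mulr1.
have sw : smooth_curve w.
  apply: (@smooth_comp R (realline R) H H u (mul b)) => //.
  exact: lie_mulr_smooth.
have kw : chart_dom k (w 0) by rewrite w0.
have dw := cinfty_differentiable (smooth_curve_chart sw kH kw).
have dt : differentiable (translate g) (chart_to k (w 0)).
  by rewrite w0; apply: cinfty_differentiable; exact: smooth_translate.
rewrite /F kb' kgb' -[in X in 'D__ _ X = _]w0.
rewrite -(@derive_comp R R V V (fun t => chart_to k (w t)) (translate g) 0 1 dw dt).
apply: near_eq_derive.
have : \forall t \near (0 : R), chart_dom k (w t).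
  by apply: (smooth_continuous sw); apply: chart_dom_near.
by apply: filterS => t kwt; rewrite /translate (good_toK gH kH kwt) lie_mulA.
Qed.

(* If a is the integral curve of F through the unit, then by left invariance
   t |-> a (s + t) and t |-> a s * a t are both integral curves through a s,
   hence equal. *)
Lemma chart_one_parameter :
  exists2 c : R -> H, one_parameter_subgroup c & velocity c = velocity u.
Proof.
have k1' : chart_from k (chart_to k one) = one by exact: (good_toK gH).
have [r [e [x [r0 e0 x0 Hx xunique]]]] := local_solution smoothF.
pose a t := chart_from k (x t).
have a0 : a 0 = one by rewrite /a x0.
have H0 (d : R) : 0 < d -> `|0 : R| < d by rewrite normr0.
have [cx0 dx0 _] := Hx 0 (H0 _ e0).
have sa : smooth_curve a.
  apply: (@smooth_comp R (realline R) (euclid R n) H x (chart_from k)) => //.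
    by apply/smooth_modelE.
  by rewrite x0; exact: smooth_from.
have [e1 e10 He1] : exists2 e1 : R, 0 < e1 & forall t, `|t| < e1 ->
    chart_dom k (a t) /\ chart_to k (a t) = x t.
  have cx : x t @[t --> (0 : R)] --> x 0 := cinfty_continuous cx0.
  have := good_img gH kH k1; rewrite -x0 => kx.
  have : \forall t \near (0 : R), chart_dom k (a t) /\ chart_to k (a t) = x t := cx _ kx.
  move=> /nbhs_normP[e1 /= e10 He1]; exists e1 => // t te.
  by apply: He1; rewrite /= sub0r normrN.
(* The products must stay in the chart and also within [r] of the centre, since [xunique] compares
   only solutions confined to that ball. *)
have [e2 e20 He2] : exists2 e2 : R, 0 < e2 & forall s t, `|s| < e2 -> `|t| < e2 ->
    chart_dom k (mul (a s) (a t)) /\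
    `|chart_to k (mul (a s) (a t)) - chart_to k one| <= r.
  pose P (b : H) := chart_dom k b /\ `|chart_to k b - chart_to k one| <= r.
  have nP : \forall b \near one, P b.
    have kd := chart_dom_near gH kH k1.
    have kr : \forall b \near one, `|chart_to k one - chart_to k b| < r.
      exact: (cvgrPdist_lt _ _).1 (good_to gH kH k1) r r0.
    near=> b; split; near: b => //.
    by apply: filterS kr => b /ltW; rewrite distrC.
  have cm : {for (0, 0), continuous (fun p : R * R => mul (a p.1) (a p.2))}.
    have [+ _] : @smooth_at R (prod_charted (realline R) (realline R)) H
        (fun p => mul (a p.1) (a p.2)) (0, 0).
      apply: (smooth2_at_comp gR gR gH gH gH) => //; exact: lie_mul_smooth.
    exact.
  have nP' : nbhs (mul (a 0) (a 0)) P by rewrite a0 lie_mul1.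
  have [[A B] /= [/nbhs_normP[d1 /= d10 Hd1] /nbhs_normP[d2 /= d20 Hd2]] ABP] := cm _ nP'.
  exists (Num.min d1 d2); first by rewrite lt_min d10.
  move=> s t; rewrite !lt_min => /andP[s1 _] /andP[_ t2].
  by apply: (ABP (s, t)); split; [apply: Hd1|apply: Hd2]; rewrite /= sub0r normrN.
(* Half of the minimum, so that [s + v] is still a time at which [x] solves the equation when [|s|]
   and [|v|] are below [d]. *)
pose d := Num.min e (Num.min e1 e2) / 2.
have m0 : 0 < Num.min e (Num.min e1 e2) by rewrite !lt_min e0 e10.
have d0 : 0 < d by rewrite divr_gt0.
have de : 2 * d <= e by rewrite mulrC divfK // ge_min lexx.
have de1 : 2 * d <= e1 by rewrite mulrC divfK // !ge_min lexx !orbT.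
have de2 : 2 * d <= e2 by rewrite mulrC divfK // !ge_min lexx !orbT.
have aD s t : `|s| < d -> `|t| < d -> `|s + t| < d -> a (s + t) = mul (a s) (a t).
  move=> sd td _.
  have s1 : `|s| < e1 by lra.
  have [kas kas'] := He1 _ s1.
  suff xD : x (s + t) = chart_to k (mul (a s) (a t)).
    have s2 : `|s| < e2 by lra.
    have t2 : `|t| < e2 by lra.
    have [kst _] := He2 s t s2 t2.
    by rewrite {1}/a xD (good_toK gH kH kst).
  have de' : d <= e by lra.
  refine (xunique d (fun t => x (s + t)) (fun t => chart_to k (mul (a s) (a t)))
    de' _ _ _ t td).
  - move=> v vd; have sve : `|s + v| < e by have := ler_normD s v; lra.
    have [_ dx xr] := Hx _ sve; split; last exact: xr.
    have dsv : is_derive v (1 : R) (fun v => s + v) (1 : R).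
      by rewrite -[X in is_derive _ _ _ X]add0r; apply: is_deriveD.
    have fx : differentiable x (s + v).
      by have [+ _] := dx; rewrite derivable1_diffP.
    have fs : differentiable (fun v => s + v) v.
      by have [+ _] := dsv; rewrite derivable1_diffP.
    apply: DeriveDef; first by apply/diff_derivable/(differentiable_comp fs fx).
    rewrite (@derive_comp R R R V (fun v => s + v) x v 1 fs fx).
    by have [_ ->] := dsv; have [_ ->] := dx.
  - move=> v vd; have s2 : `|s| < e2 by lra.
    have v2 : `|v| < e2 by lra.
    have v1 : `|v| < e1 by lra.
    have ve : `|v| < e by lra.
    have [kav nav] := He2 s v s2 v2; split; last exact: nav.
    have [kv1 kv2] := He1 v v1; have [_ dx _] := Hx v ve.
    have fx : differentiable x v by have [+ _] := dx; rewrite derivable1_diffP.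
    have ft : differentiable (translate (a s)) (x v).
      by rewrite -kv2; apply: cinfty_differentiable; exact: smooth_translate.
    apply: DeriveDef; first by apply/diff_derivable/(differentiable_comp fx ft).
    rewrite -[LHS]/('D_1 (fun v => translate (a s) (x v)) v).
    rewrite (@derive_comp R R V V x (translate (a s)) v 1 fx ft).
    by have [_ ->] := dx; rewrite -kv2 invariant.
  - by rewrite addr0 a0 lie_mulr1.
have [c [cD ca]] := extend_one_parameter d0 aD.
have ca0 : \forall t \near (0 : R), a t = c t.
  apply/nbhs_normP; exists d => // t /=; rewrite sub0r normrN => td.
  by rewrite ca.
have c0 : smooth_curve c := @smooth_ext R (realline R) H a c 0 gR ca0 sa.
exists c.
  split=> // t.
  (* Smoothness at 0 spreads to every [t] by left translation. *)
  have -> : c = (fun s => mul (c t) (c (s - t))).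
    by apply/funext => s; rewrite -cD addrC subrK.
  apply: (@smooth_comp R (realline R) H H (fun s => c (s - t)) (mul (c t))) => //.
    apply: (@smooth_comp R (realline R) (realline R) H (fun s => s - t) c) => //.
      by apply/smooth_modelE; apply: cinftyD; [exact: cinfty_id|exact: cinfty_cst].
    by rewrite subrr.
  exact: lie_mulr_smooth.
rewrite -(velocity_ext ca0).
have ka : chart_dom k (a 0) by rewrite a0.
have ku : chart_dom k (u 0) by rewrite u0.
rewrite (velocityE gH sa kH ka) (velocityE gH su kH ku) a0 u0; congr (dvec _ _ _).
transitivity ('D_1 x (0 : R)).
  apply: near_eq_derive; apply/nbhs_normP; exists e1 => // t /=.
  by rewrite sub0r normrN => /He1[].
have [_ ->] := dx0; rewrite x0 /F k1'.
by under eq_fun do rewrite lie_mul1.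
Unshelve. all: by end_near. Qed.

End OneParameterSubgroups.

Section ExpCurve.
Context {R : realType} {n : nat}.
Variable H : lie_group R n.

Lemma exp_curveP (mu : tvec H) : lie_algebra H mu ->
  one_parameter_subgroup (exp_curve mu) /\ velocity (exp_curve mu) = mu.
Proof.
move=> [u [su u0 ->]]; apply: (@xgetPex _ (fun=> lie_one H)
  [set c | one_parameter_subgroup c /\ velocity c = velocity u]).
have [k kH k1] := good_cover (good_manifold H) (lie_one H).
by have [c] := chart_one_parameter kH k1 su u0; exists c.
Qed.

Lemma one_parameter0 (c : R -> H) : one_parameter_subgroup c -> c 0 = lie_one H.
Proof.
move=> [_ cD]; apply: (@lie_mulI _ _ _ (c 0)).
by rewrite -cD addr0 lie_mulr1.
Qed.

End ExpCurve.

(** * Principal bundles *)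

Section PrincipalBundleTheory.
Context {R : realType} {m g p : nat} {M : manifold R m} {G : lie_group R g}.
Variable P : principal_bundle p M G.
Implicit Types (u v : P) (a : G).

Let gM : good M := good_manifold M.
Let gG : good G := good_manifold G.
Let gP : good P := good_manifold P.

Lemma pb_proj_act u a : pb_proj (pb_act u a) = pb_proj u :> M.
Proof. by apply/esym/pb_act_fibre; exists a. Qed.

Lemma pb_act_smooth_at u a : smooth_at (pb_act u) a.
Proof.
apply: (@smooth2_comp R G P G P (fun u a => pb_act u a) (fun=> u) id a gG gP gG gP).
- exact: pb_act_smooth.
- exact: smooth_cst.
- exact: smooth_id.
Qed.

(* In a local trivialization phi, d u v = phi(u)^-1 phi(v). *)
Lemma pb_division (x : M) : exists (U : set M) (d : P -> P -> G),
  [/\ open_nbhs x U,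
      forall u v, U (pb_proj u) -> U (pb_proj v) -> smooth2_at d u v &
      forall u a, U (pb_proj u) -> d u (pb_act u a) = a].
Proof.
have [U [phi [psi [xU Hphi _]]]] := pb_trivial P x.
exists U, (fun u v => lie_mul (lie_inv (phi u)) (phi v)); split => // [u v Uu Uv|u a Uu].
  have [su _ _] := Hphi u Uu; have [sv _ _] := Hphi v Uv.
  apply: (@smooth2_at_comp R P G P G G lie_mul (fun u => lie_inv (phi u)) phi u v) => //.
    exact: lie_mul_smooth.
  apply: (@smooth_comp R P G G phi lie_inv u gP gG gG su).
  exact: lie_inv_smooth.
by have [_ _ ->] := Hphi u Uu; rewrite lie_mulKl.
Qed.

Lemma pb_section u : exists s : M -> P,
  [/\ smooth_at s (pb_proj u), s (pb_proj u) = u &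
      \forall y \near (pb_proj u : M), pb_proj (s y) = y].
Proof.
have [U [phi [psi [[oU Uu] Hphi Hpsi]]]] := pb_trivial P (pb_proj u).
exists (fun y => psi y (phi u)); split.
- have [spsi _ _] := Hpsi _ (phi u) Uu.
  apply: (@smooth2_comp R M M G P psi id (fun=> phi u) _ gM gM gG gP spsi).
    exact: smooth_id.
  exact: smooth_cst.
- by have [_ ->] := Hphi u Uu.
- have nU : nbhs (pb_proj u : M) U by exact: open_nbhs_nbhs.
  by apply: filterS nU => y Uy; have [_ ->] := Hpsi y (phi u) Uy.
Qed.

(** Division by [u] is a smooth left inverse of the orbit map [a |-> u * a]. *)
Lemma tmap_act_inj u A : lie_algebra G A -> tmap (pb_act u) (lie_one G) A = 0 -> A = 0.
Proof.
move=> GA A0; have [U [d [[_ Uu] sd dE]]] := pb_division (pb_proj u).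
have s1 : smooth_at (d u) (pb_act u (lie_one G)).
  rewrite pb_act1.
  apply: (@smooth2_comp R P P P G d (fun=> u) id u gP gP gP gG); first exact: sd.
    exact: smooth_cst.
  exact: smooth_id.
have := tmap_comp A gG gP gG s1.
have -> : (fun a => d u (pb_act u a)) = id by apply/funext => a; rewrite dE.
by rewrite A0 tmap0 tmap_id.
Qed.

(* A curve w through u is t |-> s (y t) * a t with y its projection, s a local
   section and a a curve in G; the s (y t) factor contributes tmap s applied to
   the projection of the velocity, which is 0. *)
Lemma vertical_tmap_act u D : tangent u D -> tmap (pb_proj : P -> M) u D = 0 ->
  exists2 A, lie_algebra G A & D = tmap (pb_act u) (lie_one G) A.
Proof.
move=> [w [sw w0 ->]] D0.
have [s [ss su sp]] := pb_section u.
have [U [d [[oU Uu] sd dE]]] := pb_division (pb_proj u).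
pose y t : M := pb_proj (w t).
have sproj v : @smooth_at R P M pb_proj v by exact: pb_proj_smooth.
have y0 : y 0 = pb_proj u by rewrite /y w0.
have sy : smooth_curve y by apply: (@smooth_curve_comp R P M gP gM pb_proj w sw).
have ssy : smooth_curve (fun t => s (y t)).
  by apply: (@smooth_curve_comp R M P gM gP s y sy); rewrite y0.
pose a t := d (s (y t)) (w t).
have a0 : a 0 = lie_one G by rewrite /a y0 su w0 -[X in d _ X](pb_act1 u) dE.
have sa : smooth_curve a.
  apply: (@smooth2_comp R (realline R) P P G d (fun t => s (y t)) w 0
    good_real gP gP gG) => //.
  by rewrite y0 su w0; exact: sd.
have wE : \forall t \near (0 : R), w t = pb_act (s (y t)) (a t).
  have nU : \forall t \near (0 : R), U (y t).
    apply: (smooth_continuous sy); rewrite y0; exact: open_nbhs_nbhs.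
  have np : \forall t \near (0 : R), pb_proj (s (y t)) = y t.
    have sp' : \forall z \near y 0, pb_proj (s z) = z by rewrite y0.
    exact: (smooth_continuous sy sp').
  near=> t; have Ut : U (y t) by near: t.
  have pt : pb_proj (s (y t)) = y t by near: t.
  (* Both points lie over [y t], and [d] recovers the group element that relates them. *)
  have [b wb] : exists b, w t = pb_act (s (y t)) b.
    by have [+ _] := pb_act_fibre (s (y t)) (w t); apply; rewrite pt.
  by rewrite /a wb dE // pt.
rewrite (velocity_ext wE).
have sF : smooth2_at (fun y a => pb_act (s y) a) (y 0) (a 0).
  apply: (@smooth2_at_comp R M P G G P (fun u a => pb_act u a) s id _ _ gM gG gP gG gP).
  - exact: pb_act_smooth.
  - by rewrite y0.
  - exact: smooth_id.
rewrite (@velocity2 R M G P (fun y a => pb_act (s y) a) y a gM gG gP sy sa sF).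
rewrite a0 y0 su.
have -> : velocity (fun t => pb_act (s (y t)) (lie_one G)) = 0.
  under eq_fun do rewrite pb_act1.
  have sy0 : smooth_at s (y 0) by rewrite y0.
  rewrite -(@tmap_velocity R M P gM gP s y sy0).
  rewrite -(@tmap_velocity R P M gP gM pb_proj w (sproj _)).
  by rewrite w0 D0 tmap0.
exists (velocity a); first by rewrite /lie_algebra -a0; exact: tangent_velocity.
rewrite add0r -{1}a0 tmap_velocity //.
exact: pb_act_smooth_at.
Unshelve. all: by end_near. Qed.

Lemma fundamentalE u mu : lie_algebra G mu ->
  fundamental u mu = tmap (pb_act u) (lie_one G) mu.
Proof.
move=> /exp_curveP[oexp vexp].
rewrite -{2}vexp -(one_parameter0 oexp) tmap_velocity //.
exact: pb_act_smooth_at.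
Qed.

Lemma fundamental_tangent u mu : lie_algebra G mu -> tangent u (fundamental u mu).
Proof.
move=> Gmu; rewrite fundamentalE // -{1}(pb_act1 u).
by apply: tmap_tangent => //; exact: pb_act_smooth_at.
Qed.

Lemma tmap_proj_act u mu : lie_algebra G mu ->
  tmap (pb_proj : P -> M) u (tmap (pb_act u) (lie_one G) mu) = 0.
Proof.
move=> Gmu; rewrite -{1}(pb_act1 u) tmap_comp //; last exact: pb_proj_smooth.
by under eq_fun do rewrite pb_proj_act; rewrite tmap_cst.
Qed.

(** Evaluated at [f], the section is the derivative at [t = 0] of [f (i y * exp (t mu))], to which
    [smooth_partial] applies. *)
Lemma fundamental_section (X : charted R) (i : X -> P) (x : X) mu :
  good X -> smooth i -> lie_algebra G mu ->
  smooth_section_at i (fun y => fundamental (i y) mu) x.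
Proof.
move=> gX si Gmu; split.
  by apply: filterE => y; exact: fundamental_tangent.
move=> f sf; have [[sexp expD] vexp] := exp_curveP Gmu.
have exp0 := one_parameter0 (conj sexp expD).
have fi : smooth_fun_at (fun y =>
    'D_1 (fun t : R => f (pb_act (i y) (exp_curve mu t))) (0 : R)) x.
  apply: (@smooth_partial R X R (fun y t => f (pb_act (i y) (exp_curve mu t)))
    x gX findim_real).
  have s1 : @smooth2_at R X (realline R) P
      (fun y t => pb_act (i y) (exp_curve mu t)) x (0 : R).
    apply: (@smooth2_at_comp R X P (realline R) G P (fun u a => pb_act u a)
      i (exp_curve mu) x 0 gX good_real gP gG gP).
    - exact: pb_act_smooth.
    - exact: si.
    - exact: sexp.
  apply: (@smooth2_at_post R X (realline R) P (realline R) _ f _ _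
    gX good_real gP good_real s1).
  by rewrite exp0 pb_act1.
apply: (@smooth_ext R X (realline R) _ _ x gX _ fi).
(* The operator is this derivative only where [f] is smooth, so smoothness is needed at [i y] for
   all [y] near [x]. *)
have nf : \forall y \near x, smooth_fun_at f (i y).
  by apply: (smooth_continuous (si x)); exact: (smooth_nbhs gP findim_real sf).
apply: filterS nf => y sfv.
by rewrite /fundamental /velocity exp0 pb_act1 asboolT // derive1E.
Qed.

End PrincipalBundleTheory.

(** * The associated bundle *)

Section LocalInverses.
Context {R : realType}.
Implicit Types X Y Z : charted R.

(** The representatives are singled out by velocities of curves through [x], which depend on germs
    only. This lets formulas containing local inverses, valid only near a point, be compared as
    jets. *)
Lemma j1_ext X Y (x : X) (f f' : X -> Y) : (\forall y \near x, f y = f' y) ->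
  j1 x f = j1 x f'.
Proof.
move=> ff; rewrite /j1 (nbhs_singleton ff); congr Jet.
have germ (c : R -> X) : smooth_curve c -> c 0 = x ->
    velocity (fun t => f (c t)) = velocity (fun t => f' (c t)).
  move=> sc c0; apply: velocity_ext; rewrite -c0 in ff.
  exact: (smooth_continuous sc ff).
by apply/seteqP; split => f0 /= [sf0 f0x H]; split => // c sc c0;
  rewrite H // germ.
Qed.

Lemma local_inverse_id X Y (f : X -> Y) x g : local_inverse f x g -> g (f x) = x.
Proof. by move=> [_ _ /nbhs_singleton]. Qed.

Lemma local_inverse_sym X Y (f : X -> Y) x g :
  local_inverse f x g -> local_inverse g (f x) f.
Proof.
move=> fg; have gf := local_inverse_id fg; case: fg => sf sg n1 n2.
by split; rewrite ?gf.
Qed.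

Lemma local_inverse_comp X Y Z (f : X -> Y) (g : Y -> Z) x f' g' :
  good X -> good Y -> good Z ->
  local_inverse f x f' -> local_inverse g (f x) g' ->
  local_inverse (fun y => g (f y)) x (fun z => f' (g' z)).
Proof.
move=> gX gY gZ Hf Hg.
have f'f := local_inverse_id Hf; have g'g := local_inverse_id Hg.
case: Hf => sf sf' f1 f2; case: Hg => sg sg' g1 g2.
have f2' : \forall y \near g' (g (f x)), f (f' y) = y by rewrite g'g.
have cg' : \forall z \near g (f x), f (f' (g' z)) = g' z := smooth_continuous sg' f2'.
split.
- exact: (@smooth_comp R X Y Z f g x gX gY gZ sf sg).
- apply: (@smooth_comp R Z Y X g' f' _ gZ gY gX sg').
  by rewrite g'g.
- have g1' : \forall y \near x, g' (g (f y)) = f y := smooth_continuous sf g1.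
  by move: g1' f1; apply: filterS2 => y -> ->.
- by move: cg' g2; apply: filterS2 => z -> ->.
Qed.

End LocalInverses.

Section AssociatedBundleTheory.
Context {R : realType} {m g p : nat} {M : manifold R m} {G : lie_group R g}.
Variable P : principal_bundle p M G.

Let gM : good M := good_manifold M.
Let gG : good G := good_manifold G.
Let gP : good P := good_manifold P.
Let gE : good (euclid R m) := good_euclid m.
Local Notation zero := (0 : 'rV[R]_m).
Local Notation W := (jet (euclid R m) M * jet M P)%type.
Local Notation K := (jet (euclid R m) (euclid R m) * jet (euclid R m) G)%type.

(** At [eps 0] the section is multiplied by [a 0 = 1], so its value there does not move. *)
Lemma W11_act_fibre (w w' : W) (k : K) : W11G_ker k -> W11_act w k w' ->
  W11 w' /\ W11_pr2 w' = W11_pr2 w.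
Proof.
move=> [_ k1] [eps [s [epsV [alpha [alphaV [a [[wr ->] [kr kE] Heps Halpha ->]]]]]]].
have a1 : a zero = lie_one G by rewrite -k1 kE.
case: wr => leps ss sn; case: kr => lalpha alpha0 sa.
have epsV0 : epsV (eps zero) = zero := local_inverse_id Heps.
have alphaV0 : alphaV zero = zero by rewrite -{1}alpha0; exact: local_inverse_id Halpha.
set s' := fun y => pb_act (s y) (a (alphaV (epsV y))).
have pr2 : s' (eps zero) = s (eps zero) by rewrite /s' epsV0 alphaV0 a1 pb_act1.
split; last by rewrite /W11_pr2 /= pr2.
exists (fun z => eps (alpha z)), s'; split; last by rewrite /W11_jet alpha0.
have Heps' : local_inverse eps (alpha zero) epsV by rewrite alpha0.
have Hcomp := local_inverse_comp gE gE gM Halpha Heps'.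
split.
- by exists (fun y => alphaV (epsV y)).
- rewrite alpha0.
  have [_ sV _ _] := Hcomp; rewrite alpha0 in sV.
  apply: (@smooth2_comp R M P G P (fun u a => pb_act u a) s
    (fun y => a (alphaV (epsV y))) _ gM gP gG gP).
  + exact: pb_act_smooth.
  + exact: ss.
  + apply: (@smooth_comp R M (euclid R m) G (fun y => alphaV (epsV y)) a _ gM gE gG sV).
    by rewrite epsV0 alphaV0.
- by rewrite alpha0; apply: filterS sn => y sy; rewrite /s' pb_proj_act.
Qed.

(* Take alpha = eps^-1 o eps' and a = d (s o eps') (s' o eps'), where d is the
   division map; a 0 = 1 since s and s' agree at eps 0. *)
Lemma W11_act_transitive (w w' : W) : W11 w -> W11 w' -> W11_pr2 w = W11_pr2 w' ->
  exists2 k : K, W11G_ker k & W11_act w k w'.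
Proof.
move=> [eps [s [wr ->]]] [eps' [s' [wr' ->]]]; rewrite /W11_pr2 /= => ss'.
have Hw := wr; have Hw' := wr'.
case: wr => -[epsV Heps] ss sn; case: wr' => -[epsV' Heps'] ss'' sn'.
have x0 : eps zero = eps' zero.
  by rewrite -(nbhs_singleton sn) -(nbhs_singleton sn') ss'.
have epsV0 := local_inverse_id Heps.
have epsV0' := local_inverse_id Heps'.
pose alpha z := epsV (eps' z); pose alphaV z := epsV' (eps z).
have alpha0 : alpha zero = zero by rewrite /alpha -x0.
have Halpha : local_inverse alpha zero alphaV.
  apply: (@local_inverse_comp R (euclid R m) M (euclid R m)) => //.
  by rewrite -x0; exact: local_inverse_sym.
have [U [d [[oU Ux] sd dE]]] := pb_division P (eps zero).
have ps : pb_proj (s (eps zero)) = eps zero := nbhs_singleton sn.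
pose a z := d (s (eps' z)) (s' (eps' z)).
have a0 : a zero = lie_one G.
  by rewrite /a -x0 ss' -x0 -[X in d _ X](pb_act1 (s' (eps zero))) dE // x0 -ss' ps.
have [seps' _ _ _] := Heps'.
have sa : @smooth_at R (euclid R m) G a zero.
  apply: (@smooth2_comp R (euclid R m) P P G d (fun z => s (eps' z))
    (fun z => s' (eps' z)) zero gE gP gP gG).
  - by apply: sd; rewrite -x0 ?ps // x0 -ss' ps.
  - by apply: (@smooth_comp R (euclid R m) M P eps' s zero gE gM gP seps'); rewrite -x0.
  - exact: (@smooth_comp R (euclid R m) M P eps' s' zero gE gM gP seps').
have kr : W11G_rep alpha a by split => //; exists alphaV.
exists (W11G_jet alpha a).
  by split; [exists alpha, a|rewrite /= a0].
exists eps, s, epsV, alpha, alphaV, a; split => //.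
have [_ sepsV n1 n2] := Heps; have [_ _ n1' n2'] := Heps'.
congr (_, _); rewrite /=.
  apply: j1_ext.
  have n3 : \forall y \near eps' zero, eps (epsV y) = y by rewrite -x0.
  have n4 : \forall z \near zero, eps (epsV (eps' z)) = eps' z :=
    smooth_continuous seps' n3.
  by apply: filterS n4 => z /= zE; rewrite /alpha zE.
rewrite -x0; apply: j1_ext; rewrite -x0 in n2' sn'.
have nU : \forall y \near eps zero, U y by exact: open_nbhs_nbhs.
near=> y.
have y1 : eps (epsV y) = y by near: y.
have y2 : eps' (epsV' y) = y by near: y.
have ys : pb_proj (s y) = y by near: y.
have ys' : pb_proj (s' y) = y by near: y.
have Uy : U y by near: y.
have [b sb] : exists b, s' y = pb_act (s y) b.
  by have [+ _] := pb_act_fibre (s y) (s' y); apply; rewrite ys ys'.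
(* [alphaV (epsV y)] reduces to [epsV' y], which [eps'] sends back to [y]; hence [a] there is
   [d (s y) (s' y)], and it carries [s y] to [s' y]. *)
by rewrite /alphaV /a y1 y2 sb dE // ys.
Unshelve. all: by end_near. Qed.

Lemma W11_exists (u : P) : exists2 w : W, W11 w & W11_pr2 w = u.
Proof.
have [c cM cx] := good_cover gM (pb_proj u).
have [s [ss su sn]] := pb_section u.
pose x0 : 'rV[R]_m := chart_to c (pb_proj u).
(* An inverse chart translated so as to send 0 to the base point serves as frame. *)
pose eps (z : 'rV[R]_m) : M := chart_from c (x0 + z).
pose epsV (y : M) : 'rV[R]_m := chart_to c y - x0.
have cK : chart_from c x0 = pb_proj u by exact: (good_toK gM).
have eps0 : eps zero = pb_proj u by rewrite /eps addr0.
have st : @smooth_at R (euclid R m) (euclid R m) (fun z => x0 + z) zero.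
  by apply/smooth_modelE; apply: cinftyD; [exact: cinfty_cst|exact: cinfty_id].
have seps : @smooth_at R (euclid R m) M eps zero.
  apply: (@smooth_comp R (euclid R m) (euclid R m) M _ (chart_from c) zero gE gE gM st).
  by rewrite addr0; exact: smooth_chart_from.
have sepsV : @smooth_at R M (euclid R m) epsV (eps zero).
  rewrite eps0; apply: (@smooth_comp R M (euclid R m) (euclid R m) (chart_to c)
    (fun z => z - x0) _ gM gE gE); first exact: smooth_chart_to.
  by apply/smooth_modelE; apply: cinftyD; [exact: cinfty_id|exact: cinfty_cst].
exists (W11_jet eps s); last by rewrite /W11_pr2 /= eps0.
exists eps, s; split => //; split; [|by rewrite eps0|by rewrite eps0].
exists epsV; split => //.
  have ci := good_img gM cM cx.
  have ci' : \forall z \near x0 + zero, chart_to c (chart_from c z) = z.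
    by rewrite addr0; apply: filterS ci => z [].
  have ci0 : \forall z \near zero, chart_to c (chart_from c (x0 + z)) = x0 + z :=
    smooth_continuous st ci'.
  apply: filterS ci0 => z /= zE.
  by rewrite /epsV /eps zE addrC addKr.
rewrite eps0; apply: filterS (chart_dom_near gM cM cx) => y yc.
by rewrite /eps /epsV addrC subrK (good_toK gM cM yc).
Qed.

Section Fibres.
Context {h q : nat} {H : lie_group R h} {Q : principal_bundle q M H}.
Variable mm : set (tvec H).

Lemma assoc_classE (w : W) (mu : tvec H) : W11 w ->
  assoc_class w mu = [set z | [/\ W11 z.1, W11_pr2 z.1 = W11_pr2 w & z.2 = mu]].
Proof.
move=> Ww; apply/seteqP; split => -[w' nu] /=.
  by move=> [k kk [/(W11_act_fibre kk)[? ?] ?]].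
move=> [Ww' ww' ->]; have [k kk ak] := W11_act_transitive Ww Ww' (esym ww').
by exists k.
Qed.

Lemma assoc_mapE (i : P -> Q) (w : W) (mu : tvec H) : W11 w ->
  assoc_map i (assoc_class w mu) = fundamental (i (W11_pr2 w)) mu.
Proof.
move=> Ww; rewrite /assoc_map assoc_classE //.
(* Any representative that [xget] may pick has the same [pr2] and the same [mu]; the class contains
   [(w, mu)], so the default value 0 does not occur. *)
case: xgetP => [D ->|] /=; first by move=> [w' [nu [[/= _ -> ->] ->]]].
by move=> /(_ (fundamental (i (W11_pr2 w)) mu)) []; exists w, mu.
Qed.

Lemma assoc_class_bij (w : W) (u : P) : W11 w -> W11_pr2 w = u ->
  set_bij mm (assoc_fibre mm u) (assoc_class w).
Proof.
move=> Ww wu; split.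
- by move=> mu mmu; exists w, mu.
- move=> mu nu _ _; rewrite !assoc_classE // => E.
  have : [set z : W * tvec H |
    [/\ W11 z.1, W11_pr2 z.1 = W11_pr2 w & z.2 = mu]] (w, mu) by [].
  by rewrite E => -[].
- move=> C [w' [mu [Ww' mmu w'u ->]]]; exists mu => //.
  by rewrite !assoc_classE // w'u wu.
Qed.

Lemma assoc_map_fibre (i : P -> Q) (u : P) :
  assoc_map i @` assoc_fibre mm u = fundamental (i u) @` mm.
Proof.
apply/seteqP; split => D.
  move=> [_ [w [mu [Ww mmu wu ->]]] <-]; rewrite assoc_mapE // wu.
  by exists mu.
move=> [mu mmu <-]; have [w Ww wu] := W11_exists u.
exists (assoc_class w mu); first by exists w, mu.
by rewrite assoc_mapE // wu.
Qed.

End Fibres.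
End AssociatedBundleTheory.

(** * The decomposition *)

Section Subspaces.
Context {R : realType}.

Lemma vsubspace_map (V W : lmodType R) (A : set V) (f : V -> W) :
  vsubspace A ->
  (forall a v w, A v -> A w -> f (a *: v + w) = a *: f v + f w) ->
  vsubspace (f @` A).
Proof.
move=> [A0 AP] fP; split => [|a _ _ [v Av <-] [w Aw <-]].
  exists 0 => //; have := fP (-1) 0 0 A0 A0.
  by rewrite scaler0 addr0 scaleN1r addNr.
by exists (a *: v + w); [exact: AP|exact: fP].
Qed.

Lemma vsubspaceD (V : lmodType R) (A : set V) v w :
  vsubspace A -> A v -> A w -> A (v + w).
Proof. by move=> [_ AP] Av Aw; rewrite -[v]scale1r; exact: AP. Qed.

Lemma vsubspaceB (V : lmodType R) (A : set V) v w :
  vsubspace A -> A v -> A w -> A (v - w).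
Proof. by move=> [_ AP] Av Aw; rewrite addrC -scaleN1r; exact: AP. Qed.

(** [A] is a mere predicate, so no generating matrix is at hand: the basis is a family of
    independent rows in [A] of maximal size, which [n] bounds. *)
Lemma subspace_basis n (A : set 'rV[R]_n) : vsubspace A ->
  exists r (b : 'I_r -> 'rV[R]_n), is_basis A b.
Proof.
move=> [A0 AP].
pose indep r := `[< exists B : 'M[R]_(r, n), row_free B /\ forall k, A (row k B) >].
have indep0 : exists r, indep r.
  exists 0%N; apply/asboolP; exists 0; split; last by case.
  by rewrite -kermx_eq0 flatmx0.
have indepn r : indep r -> (r <= n)%N.
  by move=> /asboolP[B [/eqP rB _]]; have := rank_leq_col B; rewrite rB.
case: (ex_maxnP indep0 indepn) => r /asboolP[B [freeB AB]] maxr.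
exists r, (fun k => row k B).
have sumE (c : 'I_r -> R) : \sum_k c k *: row k B = (\row_k c k) *m B.
  by rewrite mulmx_sum_row; apply: eq_bigr => k _; rewrite mxE.
have ker0 s (C : 'M[R]_(s, n)) : row_free C -> forall u : 'rV_s, u *m C = 0 -> u = 0.
  move=> freeC u uC; apply: (row_free_inj freeC).
  by rewrite uC mul0mx.
split=> [c|].
  by rewrite sumE => /(ker0 _ _ freeB)/rowP c0 k; have := c0 k; rewrite !mxE.
rewrite eqEsubset; split => [v Av|_ [c ->]]; last first.
  elim: (index_enum _) => [|k l IH]; first by rewrite big_nil.
  by rewrite big_cons; exact: AP.
have [/submxP[D ->]|vB] := boolP (v <= B)%MS.
  exists (fun k => D ord0 k); rewrite sumE; congr (_ *m _).
  by apply/rowP => k; rewrite mxE.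
(* A vector of [A] outside the row space of [B] could be appended to [B], against maximality. *)
suff : indep (r + 1)%N by move=> /maxr; rewrite addn1 ltnn.
apply/asboolP; exists (col_mx B v); split; last first.
  move=> k; case: (split_ordP k) => l ->.
    by rewrite rowKu.
  by rewrite rowKd [row _ _]row_id.
rewrite -kermx_eq0; apply/rowV0P => u /sub_kermxP.
rewrite -[u]hsubmxK mul_row_col => uBv.
have u2 : rsubmx u = 0.
  apply/rowP => l; rewrite ord1 [RHS]mxE.
  (* In a dependency, a nonzero coefficient at [v] could be divided out, putting [v] in the row
     space of [B]. *)
  have [//|/eqP u0] := eqVneq (rsubmx u 0 0) 0.
  move/negP: vB; case.
  have u2v : rsubmx u *m v = rsubmx u 0 0 *: v.
    by rewrite [rsubmx u in LHS]mx11_scalar mul_scalar_mx.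
  have /(congr1 (fun w => (rsubmx u 0 0)^-1 *: w)) := uBv.
  rewrite u2v scaler0 scalerDr scalerA mulVf; last exact/eqP.
  rewrite scale1r => /eqP; rewrite addrC addr_eq0 => /eqP ->.
  by rewrite -scaleNr; apply: scalemx_sub; exact: submxMl.
move: uBv; rewrite u2 mul0mx addr0 => /(ker0 _ _ freeB) ->.
by rewrite row_mx0.
Qed.

End Subspaces.

(** * The splitting and its two smooth summands *)

Section ReductiveStructureTheory.
Context {R : realType} {m g h p q : nat} {M : manifold R m}.
Context {G : lie_group R g} {H : lie_group R h}.
Context {P : principal_bundle p M G} {Q : principal_bundle q M H}.
Context {j : G -> H} {i : P -> Q} {mm : set (tvec H)}.
Hypothesis reductive : reductive_structure j i mm.

Let gM : good M := good_manifold M.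
Let gG : good G := good_manifold G.
Let gH : good H := good_manifold H.
Let gP : good P := good_manifold P.
Let gQ : good Q := good_manifold Q.

Lemma lie_algebra_subspace : vsubspace (lie_algebra H).
Proof. exact: tangent_subspace. Qed.

Lemma complement_subspace : vsubspace mm.
Proof. by case: reductive => _ _ [[]]. Qed.

Lemma complement_sub : mm `<=` lie_algebra H.
Proof.
case: reductive => _ _ [[[g0 _] _ _ ->] _] mu mmu.
by exists 0, mu; rewrite add0r.
Qed.

Lemma smooth_inclusion : smooth i.
Proof. by case: reductive => _ [[]]. Qed.

Lemma smooth_subgroup : smooth j.
Proof. by case: reductive => [[[]]]. Qed.

Lemma subgroup1 : j (lie_one G) = lie_one H.
Proof.
case: reductive => [[_ _ jM] _ _]; apply: (@lie_mulI _ _ _ (j (lie_one G))).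
by rewrite -jM lie_mul1 lie_mulr1.
Qed.

Lemma fundamentalP (v : Q) a mu nu : lie_algebra H mu -> lie_algebra H nu ->
  fundamental v (a *: mu + nu) = a *: fundamental v mu + fundamental v nu.
Proof.
move=> Hmu Hnu; rewrite !fundamentalE ?tmapP //.
by have [_] := lie_algebra_subspace; exact.
Qed.

Lemma fundamental_eq0 (v : Q) mu : lie_algebra H mu -> fundamental v mu = 0 -> mu = 0.
Proof. by move=> Hmu; rewrite fundamentalE //; exact: tmap_act_inj. Qed.

Lemma fundamental_inj (v : Q) mu nu : lie_algebra H mu -> lie_algebra H nu ->
  fundamental v mu = fundamental v nu -> mu = nu.
Proof.
move=> Hmu Hnu E; apply/eqP; rewrite -subr_eq0; apply/eqP.
apply: (@fundamental_eq0 v); first exact: vsubspaceB lie_algebra_subspace Hmu Hnu.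
by rewrite addrC -scaleN1r fundamentalP // E scaleN1r addNr.
Qed.

Lemma fundamental_vertical (v : Q) mu : lie_algebra H mu -> vertical v (fundamental v mu).
Proof.
move=> Hmu; split; first exact: fundamental_tangent.
by rewrite /= fundamentalE // tmap_proj_act.
Qed.

(** Equivariance of [i] along [j], differentiated at the unit of [G]. *)
Lemma tmap_inclusion_act (u : P) A : lie_algebra G A ->
  tmap i u (tmap (pb_act u) (lie_one G) A) =
  tmap (pb_act (i u)) (lie_one H) (tmap j (lie_one G) A).
Proof.
case: reductive => [_ [_ _ iact _] _] GA.
have -> : tmap i u = tmap i (pb_act u (lie_one G)) by rewrite pb_act1.
rewrite tmap_comp //; last exact: smooth_inclusion.
rewrite -subgroup1 tmap_comp //; last exact: pb_act_smooth_at.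
by congr (tmap _ _ _); apply/funext => a; rewrite iact.
Qed.

Lemma tmap_subgroup A : lie_algebra G A -> lie_algebra H (tmap j (lie_one G) A).
Proof.
move=> GA; rewrite /lie_algebra -subgroup1; apply: tmap_tangent => //.
exact: smooth_subgroup.
Qed.

Lemma tmap_proj_inclusion (u : P) D :
  tmap (pb_proj : Q -> M) (i u) (tmap i u D) = tmap (pb_proj : P -> M) u D.
Proof.
case: reductive => [_ [_ _ _ iproj] _].
rewrite tmap_comp //; last exact: pb_proj_smooth.
by congr (tmap _ _ _); apply/funext => v; rewrite iproj.
Qed.

Lemma tmap_inclusion_tangent (u : P) D : tangent u D -> tangent (i u) (tmap i u D).
Proof. by move=> uD; apply: tmap_tangent => //; exact: smooth_inclusion. Qed.

(* D in T_(i u) Q projects to X in T M; D minus the image of the lift of X by a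
   local section of P is vertical, i.e. the fundamental vector of some element of
   lie_algebra H, which splits as the sum of a part from G and a part in mm. *)
Lemma inclusion_direct_sum (u : P) :
  direct_sum (tmap i u @` tangent u) (fundamental (i u) @` mm) (tangent (i u)).
Proof.
have tP := tangent_subspace u gP; have tQ := tangent_subspace (i u) gQ.
have [_ _ [[_ _ mm0 HE] _]] := reductive.
split.
- by apply: vsubspace_map => // a v w _ _; exact: tmapP.
- apply: vsubspace_map; first exact: complement_subspace.
  by move=> a mu nu /complement_sub Hmu /complement_sub Hnu; exact: fundamentalP.
- rewrite eqEsubset; split => [D|_ ->]; last first.
    split; first by exists 0; [exact: tP.1|exact: tmap0].
    exists 0; first exact: complement_subspace.1.
    by rewrite fundamentalE ?tmap0 //; exact: lie_algebra_subspace.1.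
  move=> [[E uE <-] [mu mmu muE]]; have Hmu := complement_sub mmu.
  (* A common vector is vertical in [Q], so [E] is vertical in [P] and comes from some [A] in the
     Lie algebra of [G]; then [mu] is the image of [A] and lies in both summands of the Lie algebra
     of [H]. *)
  have E0 : tmap (pb_proj : P -> M) u E = 0.
    rewrite -tmap_proj_inclusion -muE.
    by have [] := fundamental_vertical (i u) Hmu.
  have [A GA EA] := vertical_tmap_act uE E0.
  have muA : mu = tmap j (lie_one G) A.
    apply: (@fundamental_inj (i u)) => //; first exact: tmap_subgroup.
    by rewrite muE EA tmap_inclusion_act // [RHS]fundamentalE //; exact: tmap_subgroup.
  have mu0 : mu = 0.
    suff : [set (0 : tvec H)] mu by [].
    by rewrite -mm0; split => //; exists A.
  rewrite -muE mu0 fundamentalE ?tmap0 //; exact: lie_algebra_subspace.1.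
rewrite eqEsubset; split => [D QD|_ [_ [_ [[E uE <-] [mu mmu <-] ->]]]]; last first.
  apply: vsubspaceD => //; first exact: tmap_inclusion_tangent.
  by apply: fundamental_tangent; exact: complement_sub.
have [s [ss su sn]] := pb_section u.
pose X := tmap (pb_proj : Q -> M) (i u) D.
have iproj : pb_proj (i u) = pb_proj u :> M by case: reductive => _ [].
have TX : tangent (pb_proj u : M) X.
  by rewrite -iproj; apply: tmap_tangent => //; exact: pb_proj_smooth.
pose E := tmap s (pb_proj u) X.
have TE : tangent u E by rewrite -[in tangent u]su; exact: tmap_tangent.
have EX : tmap (pb_proj : P -> M) u E = X.
  rewrite /E -[in tmap pb_proj u]su tmap_comp //; last exact: pb_proj_smooth.
  rewrite (@tmap_ext _ _ _ gM gM _ id) ?tmap_id //.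
  apply: (@smooth_comp R M P M s pb_proj _ gM gP gM ss).
  exact: pb_proj_smooth.
pose D' := D - tmap i u E.
have TD' : tangent (i u) D'.
  by apply: vsubspaceB => //; exact: tmap_inclusion_tangent.
have D'0 : tmap (pb_proj : Q -> M) (i u) D' = 0.
  by rewrite tmapB tmap_proj_inclusion EX subrr.
have [B HB DB] := vertical_tmap_act TD' D'0.
move: HB; rewrite HE => -[_ [mu [[A GA <-] mmu BE]]].
(* The part of the vertical remainder that comes from [G] is tangent to [P] and is added to the lift
   [E]. *)
exists (tmap i u (E + tmap (pb_act u) (lie_one G) A)), (fundamental (i u) mu).
split.
- exists (E + tmap (pb_act u) (lie_one G) A) => //.
  apply: vsubspaceD => //.
  have -> : tangent u = tangent (pb_act u (lie_one G)) by rewrite pb_act1.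
  by apply: tmap_tangent => //; exact: pb_act_smooth_at.
- by exists mu.
rewrite tmapD tmap_inclusion_act // fundamentalE; last exact: complement_sub.
by rewrite -addrA -tmapD -BE -DB /D' addrC subrK.
Qed.

Lemma smooth_section_ext (X Y : charted R) (f : X -> Y) (s t : X -> tvec Y) x :
  good X -> (\forall y \near x, s y = t y) ->
  smooth_section_at f s x -> smooth_section_at f t x.
Proof.
move=> gX st [sT sS]; split; first by move: st sT; apply: filterS2 => y ->.
move=> k /sS; apply: (@smooth_ext R X (realline R)) => //.
by apply: filterS st => y ->.
Qed.

(** The local frame is the image of the coordinate frame of a chart of [P]; it stays independent
    because [i] is an immersion. *)
Lemma tangent_subbundle : vector_subbundle i (fun u => tmap i u @` tangent u) p.
Proof.
move=> u; have [c cP cu] := good_cover gP u.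
have si := smooth_inclusion; have iinj : immersion i by case: reductive => _ [].
pose e k (v : P) := dvec (c : chart P (charted_model P)) v (delta_mx ord0 k : 'rV[R]_p).
exists (fun k v => tmap i v (e k v)).
have nc := chart_dom_near gP cP cu.
split=> [k|]; last first.
  apply: filterS nc => v vc.
  apply: (@is_basis_map R _ _ (tangent v) (tmap i v) p (fun k => e k v)).
  - exact: tangent_subspace.
  - by move=> a D E _ _; exact: tmapP.
  - by move=> D vD; exact: iinj.2.
  - exact: tangent_basis.
split.
  apply: filterS nc => v vc; apply: tmap_inclusion_tangent.
  by rewrite (tangentE gP cP vc); exists (delta_mx ord0 k : 'rV[R]_p).
move=> f sf.
have sfi : smooth_fun_at (fun v => f (i v)) u by exact: (smooth_fun_comp gP gQ).
have nf : \forall v \near u, smooth_fun_at f (i v).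
  by apply: (smooth_continuous (si u)); exact: (smooth_nbhs gQ findim_real sf).
apply: (@smooth_ext R P (realline R) (fun v => e k v (fun w => f (i w)))) => //.
  by apply: filterS nf => v sfv; rewrite /tmap asboolT.
exact: smooth_dvec.
Qed.

(** A chart at the unit identifies the Lie algebra with row vectors through [dvec], which moves the
    question to matrices. *)
Lemma complement_basis : exists r (b : 'I_r -> tvec H), is_basis mm b.
Proof.
have [k kH k1] := good_cover gH (lie_one H).
have [mm0 mmP] := complement_subspace.
pose f (w : 'rV[R]_h) : tvec H := dvec (k : chart H (charted_model H)) (lie_one H) w.
have fP a v w : f (a *: v + w) = a *: f v + f w by exact: dvecP.
pose A := [set w | mm (f w)].
have As : vsubspace A.
  split; last by move=> a v w Av Aw; have := mmP a _ _ Av Aw; rewrite -fP.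
  have := fP (-1) 0 0; rewrite scaler0 addr0 scaleN1r addNr => f0.
  by rewrite /A /= f0.
have [r [b bA]] := subspace_basis As.
exists r, (f \o b).
have <- : f @` A = mm.
  rewrite eqEsubset; split => [_ [w Aw <-] //|mu mmu].
  have := complement_sub mmu; rewrite /lie_algebra (tangentE gH kH k1) => -[w _ wmu].
  by exists w => //; rewrite /A /= /f wmu.
apply: (@is_basis_map R _ _ A f) => //.
by move=> v _; exact: dvec_inj.
Qed.

(** The fundamental fields of a basis of [mm] form a frame over all of [P]. *)
Lemma complement_subbundle r (b : 'I_r -> tvec H) : is_basis mm b ->
  vector_subbundle i (fun u => fundamental (i u) @` mm) r.
Proof.
move=> bmm u; exists (fun k v => fundamental (i v) (b k)).
have Hb k : lie_algebra H (b k) by apply: complement_sub; exact: is_basis_mem bmm.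
split=> [k|].
  by apply: fundamental_section => //; exact: smooth_inclusion.
apply: filterE => v.
apply: (@is_basis_map R _ _ mm (fundamental (i v)) r b) => //.
- exact: complement_subspace.
- by move=> a mu nu /complement_sub Hmu /complement_sub Hnu; exact: fundamentalP.
- by move=> mu /complement_sub; exact: fundamental_eq0.
Qed.

End ReductiveStructureTheory.

Theorem theorem4p12 (R : realType) (m g h p q : nat) (M : manifold R m)
  (G : lie_group R g) (H : lie_group R h)
  (P : principal_bundle p M G) (Q : principal_bundle q M H)
  (j : G -> H) (i : P -> Q) (mm : set (tvec H))
  (reductive : reductive_structure j i mm) :
  (* M(P) is a vector bundle with typical fibre mm, and it is a vector subbundle
     of i_P^*(VQ) through assoc_map *)
  [/\ (forall w (u : P), W11 w -> W11_pr2 w = u ->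
         set_bij mm (assoc_fibre mm u) (assoc_class w)),
      (forall (w : jet (euclid R m) M * jet M P) mu, W11 w -> mm mu ->
         assoc_map i (assoc_class w mu) = fundamental (i (W11_pr2 w)) mu),
      (forall (w : jet (euclid R m) M * jet M P) (a : R) mu nu,
         W11 w -> mm mu -> mm nu ->
         assoc_map i (assoc_class w (a *: mu + nu)) =
           a *: assoc_map i (assoc_class w mu) + assoc_map i (assoc_class w nu)),
      (forall u : P,
         set_inj (assoc_fibre mm u) (assoc_map i) /\
         assoc_map i @` assoc_fibre mm u `<=` vertical (i u)) &
      (forall (s : P -> jet (euclid R m) M * jet M P) (u : P) mu,
         (\forall v \near u, W11 (s v) /\ W11_pr2 (s v) = v) -> mm mu ->
         smooth_section_at i (fun v => assoc_map i (assoc_class (s v) mu)) u)] /\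
  (* i_P^*(TQ) = TP (+) M(P) as vector bundles over P *)
  [/\ vector_subbundle i (fun u => tmap i u @` tangent u) p,
      (exists (r : nat) (b : 'I_r -> tvec H), is_basis mm b /\
         vector_subbundle i (fun u => assoc_map i @` assoc_fibre mm u) r) &
      forall u : P,
        direct_sum (tmap i u @` tangent u)
                   (assoc_map i @` assoc_fibre mm u) (tangent (i u))].

Proof.
have si := smooth_inclusion reductive.
have mmH := complement_sub reductive.
split; split.
- by move=> w u; exact: assoc_class_bij.
- by move=> w mu Ww _; exact: assoc_mapE.
- move=> w a mu nu Ww mmu mnu; rewrite !assoc_mapE //.
  by apply: fundamentalP; exact: mmH.
- move=> u; split; last first.
    rewrite assoc_map_fibre => _ [mu mmu <-].
    by apply: fundamental_vertical; exact: mmH.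
  move=> C C'; rewrite !inE => -[w [mu [Ww mmu wu ->]]] [w' [mu' [Ww' mmu' wu' ->]]].
  rewrite !assoc_mapE // wu wu' => /fundamental_inj E.
  (* Once the two elements of [mm] agree, so do the classes, which depend only on the point [u] and
     on that element. *)
  by rewrite E; [rewrite !assoc_classE // wu wu'|exact: mmH|exact: mmH].
- move=> s u mu ns mmu.
  (* Nothing is assumed about the smoothness of [s]: near [u] the vector depends on [s v] only
     through its projection [v]. *)
  apply: (@smooth_section_ext R P Q i (fun v => fundamental (i v) mu)).
  + exact: good_manifold.
  + by apply: filterS ns => v [Ws sv]; rewrite assoc_mapE // sv.
  + by apply: fundamental_section; [exact: good_manifold|exact: si|exact: mmH].
- exact: (tangent_subbundle reductive).
- have [r [b bmm]] := complement_basis reductive; exists r, b; split => //.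
  under eq_fun do rewrite assoc_map_fibre.
  exact: (complement_subbundle reductive bmm).
- by move=> u; rewrite assoc_map_fibre; exact: (inclusion_direct_sum reductive).
Qed.
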